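(* There is $n_0$ such that if $n\ge n_0$ and $H$ is a $4$-graph on $n$ vertices that does not contain $PG_2(3)$, then $\delta_3(H)<n/2$.
   Context: For a $k$-graph $H$ and $S\subseteq V(H)$, $N_H(S)=\{T\subseteq V(H)\setminus S:S\cup T\in E(H)\}$ and $\delta_s(H)=\min_{|S|=s}|N_H(S)|$. ''Contains'' means as a (not necessarily induced) subgraph. $PG_2(3)$ is the $4$-graph whose $13$ vertices are the one-dimensional subspaces of $\mathbb{F}_3^3$ and whose edges are, for each two-dimensional subspace, the set of one-dimensional subspaces it contains. *)

(* Defs.v *)
From HB Require Import structures.
From mathcomp Require Import all_boot all_order all_algebra.
Set Implicit Arguments. Unset Strict Implicit. Unset Printing Implicit Defensive.
Import GRing.Theory.
Local Open Scope ring_scope.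

Notation vec3 := ('rV['F_3]_3).

Definition pg_points : {set {set vec3}} :=
  [set S | [exists v : vec3, (v != 0) && (S == [set a *: v | a : 'F_3])]].

Definition pg_planes : {set {set vec3}} :=
  [set W | [exists u : vec3, exists v : vec3,
     (\rank (col_mx u v) == 2) &&
     (W == [set a *: u + b *: v | a : 'F_3, b : 'F_3])]].

Definition pg_line (W : {set vec3}) : {set {set vec3}} :=
  [set P in pg_points | P \subset W].

Definition is_kgraph (k : nat) (T : finType) (E : {set {set T}}) : Prop :=
  forall e, e \in E -> #|e| = k.

Definition contains_PG23 (T : finType) (E : {set {set T}}) : Prop :=
  exists f : {set vec3} -> T,
    {in pg_points &, injective f} /\
    forall W, W \in pg_planes -> f @: pg_line W \in E.

Definition nbhd (T : finType) (E : {set {set T}}) (S : {set T}) : {set {set T}} :=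
  [set U : {set T} | [disjoint U & S] && (S :|: U \in E)].

(* delta_s(H) = min over s-subsets S of |N_H(S)|.  The default value 2^(2^|T|)
   exceeds every |N_H(S)| and is only used when there are no s-subsets. *)
Definition delta (s : nat) (T : finType) (E : {set {set T}}) : nat :=
  \big[minn/(2 ^ (2 ^ #|T|))%N]_(S : {set T} | #|S| == s) #|nbhd E S|.

(* Main.v *)
Require Import Defs.
From HB Require Import structures.
From mathcomp Require Import all_boot all_order all_algebra.
From mathcomp Require Import zify.
Set Implicit Arguments. Unset Strict Implicit. Unset Printing Implicit Defensive.

(** Suppose that [n <= 2 * delta 3 H] and that [H] has no PG_2(3).  Deleting a point of PG_2(3) leaves
    a 4-partite 4-graph on four triples, so no vertex [v] completes triples in all parts of a complete
    4-partite subgraph [V1, V2, V3, V4].  Take a bounded set [U] whose neighbourhood [N U] (the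
    vertices completing some triple of [U]) hardly shrinks on large subsets of [U].  Most [v] in
    [N U] have a dense link on [U], hence see a complete tripartite piece of it, and then triples of
    such [v] with the same tripartite piece have neighbourhoods nearly disjoint from [N U], that is,
    nearly its complement.  This splits the vertices into almost equal parts [A], [B] such that
    almost all 4-sets meeting [A] in an odd number of vertices are edges.

    Call a vertex good for [A] if its link on [B] is nearly complete, and conversely.  An edge inside
    the vertices good for [A] is a line at infinity whose affine plane is found in [B], so there is
    none, and no link is dense on both [A] and [B].  Counting the neighbours of triples inside each
    side then leaves no room for vertices that are good for neither side; so both sides have exactly
    [n / 2] vertices, contain no edge, and all 4-sets of odd type are edges.

    Finally each pair [u, v] on one side gives a graph on the other one, with edges the [b b'] such
    that [u v b b'] is an edge, of minimum degree at least 2.  Disjoint edges in the three graphs of a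
    triangle [u, v, w] would give PG_2(3); so these graphs all have the same two centres of large
    degree.  This holds on both sides, and a double count of edges contradicts it. *)

(** * Complete multipartite subgraphs of dense hypergraphs *)

Lemma pigeonhole_sum (I : finType) (D : {set I}) (F : I -> nat) M K :
  #|D| <= K -> M <= \sum_(i in D) F i -> 0 < M -> exists2 i, i \in D & M <= K * F i.
Proof.
move=> leDK leM M0.
have [/existsP[i /andP[iD Hi]]|/existsPn H] := boolP [exists i in D, M <= K * F i].
  by exists i.
have : K * \sum_(i in D) F i <= #|D| * M.-1.
  rewrite big_distrr /= -sum_nat_const; apply: leq_sum => i iD.
  by move: (H i); rewrite iD /= -ltnNge; lia.
have : 0 < #|D|.
  rewrite lt0n; apply/eqP => D0; move: leM; rewrite big1 ?leqn0; first by lia.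
  by move=> i; rewrite (cards0_eq D0) inE.
nia.
Qed.

Lemma exists_card_subset (X : finType) (S : {set X}) s :
  s <= #|S| -> exists2 S' : {set X}, S' \subset S & #|S'| = s.
Proof.
move=> leS; have : 0 < #|[set B : {set X} | (B \subset S) && (#|B| == s)]|.
  by rewrite cards_draws bin_gt0.
by case/card_gt0P=> B; rewrite inE => /andP[? /eqP ?]; exists B.
Qed.

(** Deleting a point where [f] is minimal does not lower the average of [f]; repeat until [s] points
    are left. *)
Lemma exists_dense_subset (X : finType) (f : X -> nat) (S : {set X}) s :
  s <= #|S| -> exists S' : {set X}, [/\ S' \subset S, #|S'| = s
    & s * \sum_(x in S) f x <= #|S| * \sum_(x in S') f x].
Proof.
move=> leS; move: {-2}#|S| (erefl #|S|) leS => m.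
elim: m S => [|m IH] S Sm leS.
  by exists S; split=> //; lia.
have [->|ns] := eqVneq s m.+1; first by exists S; split=> //; rewrite Sm.
have [x0 x0S] : exists x, x \in S by apply/card_gt0P; rewrite -Sm.
have [x xS minx] := arg_minnP f x0S; have {}xS : x \in S := xS.
have Hx : #|S :\ x| = m by rewrite (cardsD1 x) xS in Sm; lia.
have [|S' [sub cS' H]] := IH (S :\ x) (esym Hx); first by lia.
exists S'; split=> //; first exact: subset_trans sub (subD1set _ _).
have E : \sum_(y in S) f y = f x + \sum_(y in S :\ x) f y by rewrite (big_setD1 x).
have le : m * f x <= \sum_(y in S :\ x) f y.
  by rewrite -Hx -sum_nat_const; apply: leq_sum => y /setD1P[_ yS]; exact: minx.
rewrite E; move: (\sum_(y in S :\ x) f y) (\sum_(y in S') f y) le H => a b le H.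
have [m0|m0] := posnP m; first by lia.
have : m * (s * (f x + a)) <= m * (m.+1 * b) by nia.
by rewrite leq_pmul2l.
Qed.

(** Parameters of [dense_common_nbrs]: on [step_size] points, density [1 / q] means average degree
    at least [2 * t]. In [step_loss] the factor [2 * q] pays for the vertices of small degree, the
    power of 2 for the choice of [Y]. *)
Definition step_size q t := 2 * q * t.
Definition step_loss q t := 2 * q * 2 ^ step_size q t.

(** A Kovari-Sos-Turan argument: some [S'] of bounded size keeps the density, at least [1 / (2 * q)]
    of [A] has [t] neighbours in [S'], and by pigeonhole one [t]-subset of [S'] serves many of
    these. *)
Lemma dense_common_nbrs q t (P X : finType) (A : {set P}) (S : {set X}) (e : P -> X -> bool) :
  0 < q -> 0 < t -> step_size q t <= #|S| ->
  #|A| * #|S| <= q * \sum_(p in A) \sum_(x in S) e p x ->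
  exists Y : {set X}, [/\ Y \subset S, #|Y| = t
    & #|A| <= step_loss q t * \sum_(p in A) [forall x in Y, e p x]].
Proof.
rewrite /step_loss; set s := step_size q t => q0 t0 leS dense.
have ts : t <= s by rewrite /s /step_size; nia.
have [A0|A0] := posnP #|A|.
  have [Y ? ?] := exists_card_subset (leq_trans ts leS).
  by exists Y; split; rewrite // A0.
have s0 : 0 < s by lia.
pose f x := \sum_(p in A) e p x.
have [S' [subS cS' H]] := exists_dense_subset f leS.
have {H} dense' : #|A| * s <= q * \sum_(p in A) \sum_(x in S') e p x.
  rewrite exchange_big /= -/f in dense.
  rewrite exchange_big /= -/f.
  move: (\sum_(x in S) f x) (\sum_(x in S') f x) dense H => a b d1 d2.
  have S0 : 0 < #|S| by lia.
  rewrite -(leq_pmul2l S0).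
  have h : q * (s * a) <= q * (#|S| * b) by rewrite leq_mul2l d2 orbT.
  have h' : s * (#|A| * #|S|) <= s * (q * a) by rewrite leq_mul2l d1 orbT.
  by apply: leq_trans (_ : q * (s * a) <= _); lia.
pose deg p := #|[set x in S' | e p x]|.
have degE p : \sum_(x in S') e p x = deg p.
  by rewrite /deg -sum1_card big_mkcond [RHS]big_mkcond; apply: eq_bigr => x _; rewrite inE; case: (x \in S'); case: (e p x).
pose Q := [set p in A | t <= deg p].
have bound : \sum_(p in A) deg p <= #|Q| * s + #|A| * t.
  rewrite -sum1_card big_distrl /= -[in X in _ <= _ + X]sum_nat_const.
  rewrite big_mkcond [X in _ <= X + _]big_mkcond [X in _ <= _ + X]big_mkcond -big_split /=.
  apply: leq_sum => p _; rewrite inE; case: (p \in A) => //=.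
  case: (leqP t (deg p)) => [_|/ltnW le_t]; last first.
  by apply: leq_trans le_t _; exact: leq_addl.
  apply: leq_trans (leq_addr _ _).
  by rewrite mul1n -cS'; apply: subset_leq_card; apply/subsetP => x; rewrite inE => /andP[].
have QA : #|A| <= 2 * q * #|Q|.
  rewrite (eq_bigr _ (fun p _ => degE p)) in dense'.
  have h : #|A| * s <= q * (#|Q| * s + #|A| * t).
    by apply: leq_trans dense' _; rewrite leq_mul2l bound orbT.
  move: h; rewrite /s /step_size; move: #|A| #|Q| => a b h.
  have qt0 : 0 < q * t by rewrite muln_gt0 q0.
  rewrite -(leq_pmul2l qt0); nia.
pose D := [set Y : {set X} | (Y \subset S') && (#|Y| == t)].
have cD : #|D| <= 2 ^ s.
  rewrite -cS' -card_powerset; apply: subset_leq_card; apply/subsetP => Y.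
  by rewrite !inE => /andP[].
have sumD : #|Q| <= \sum_(Y in D) \sum_(p in A) [forall x in Y, e p x].
  rewrite exchange_big /= -sum1_card big_mkcond [X in _ <= X]big_mkcond /=.
  apply: leq_sum => p _; rewrite inE; case: (p \in A) => //=.
  case: (leqP t (deg p)) => // /exists_card_subset[Y subY cY].
  rewrite (bigD1 Y) /=; last first.
    rewrite inE cY eqxx andbT; apply: subset_trans subY _.
    by apply/subsetP => x; rewrite inE => /andP[].
  suff -> : [forall x in Y, e p x] by [].
  by apply/forall_inP => x /(subsetP subY); rewrite inE => /andP[].
have Q0 : 0 < #|Q| by nia.
have [Y] := pigeonhole_sum cD sumD Q0.
rewrite inE => /andP[subY /eqP cY] HY; exists Y; split=> //.
  exact: subset_trans subY subS.
by apply: leq_trans QA _; rewrite -[leqRHS]mulnA leq_mul2l HY orbT.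
Qed.

Lemma sum_setX (X Y : finType) (A : {set X}) (B : {set Y}) (F : X -> Y -> nat) :
  \sum_(p in setX A B) F p.1 p.2 = \sum_(x in A) \sum_(y in B) F x y.
Proof.
rewrite pair_big /=; apply: eq_bigl => p; by rewrite inE.
Qed.

Definition tripartite_bound q t R := forall (X : finType) (U : {set X}) (e : X -> X -> X -> bool),
  R <= #|U| -> 0 < q -> 0 < t ->
  #|U| ^ 3 <= q * \sum_(x in U) \sum_(y in U) \sum_(z in U) e x y z ->
  exists V1 V2 V3 : {set X}, [/\ V1 \subset U, V2 \subset U & V3 \subset U] /\
   [/\ #|V1| = t, #|V2| = t, #|V3| = t &
    forall x y z, x \in V1 -> y \in V2 -> z \in V3 -> e x y z].

(** The theorem of Erdos on complete multipartite subgraphs, one coordinate at a time: each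
    application of [dense_common_nbrs] fixes a part and leaves a dense relation in fewer
    variables. *)
Lemma complete_tripartite q t : exists R, tripartite_bound q t R.
Proof.
pose q1 := step_loss q t; pose q2 := step_loss q1 t.
have loss0 q' : 0 < q' -> 0 < step_loss q' t.
  by move=> h; rewrite /step_loss !muln_gt0 h expn_gt0.
exists (maxn (step_size q t) (maxn (step_size q1 t) (maxn (step_size q2 t) 1))) => X U e.
rewrite !geq_max => /and4P[s1 s2 s3 U0] q0 t0 dense.
have q10 := loss0 _ q0; have q20 := loss0 _ q10.
have [|V3 [sub3 c3 H3]] := @dense_common_nbrs q t _ _ (setX U U) U (fun p => e p.1 p.2) q0 t0 s1.
  rewrite cardsX (sum_setX _ _ (fun x y => \sum_(z in U) e x y z)).
  by move: dense; rewrite !expnS expn0 muln1 mulnA.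
rewrite cardsX (sum_setX _ _ (fun x y => [forall z in V3, e x y z] : nat)) in H3.
have [|V2 [sub2 c2 H2]] := @dense_common_nbrs q1 t _ _ U U (fun x y => [forall z in V3, e x y z]) q10 t0 s2.
  by [].
(* Only the first coordinate is left, so the other side is the single point [tt], and a nonzero
   count already means completeness. *)
have [|V1 [sub1 c1 H1]] := @dense_common_nbrs q2 t _ _ [set tt] U
    (fun _ x => [forall y in V2, [forall z in V3, e x y z]]) q20 t0 s3.
  by rewrite cards1 mul1n big_set1.
exists V1, V2, V3; split=> //; split=> //.
move: H1; rewrite cards1 big_set1; case: forall_inP => [H1 _|_]; last by rewrite muln0.
by move=> x y z /H1 /forall_inP H /H /forall_inP; apply.
Qed.

(** Pairing triples with the last coordinate, one use of [dense_common_nbrs] leaves a ternary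
    relation of density [1 / q1]. *)
Lemma complete_fourpartite q t : exists R, forall (X : finType) (U : {set X}) (e : X -> X -> X -> X -> bool),
  R <= #|U| -> 0 < q -> 0 < t ->
  #|U| ^ 4 <= q * \sum_(x in U) \sum_(y in U) \sum_(z in U) \sum_(w in U) e x y z w ->
  exists V1 V2 V3 V4 : {set X}, [/\ V1 \subset U, V2 \subset U, V3 \subset U & V4 \subset U] /\
   [/\ #|V1| = t, #|V2| = t, #|V3| = t, #|V4| = t &
    forall x y z w, x \in V1 -> y \in V2 -> z \in V3 -> w \in V4 -> e x y z w].
Proof.
pose q1 := step_loss q t.
have [R HR] := complete_tripartite q1 t.
exists (maxn R (step_size q t)) => X U e; rewrite geq_max => /andP[s1 s2] q0 t0 dense.
have q10 : 0 < q1 by rewrite /q1 /step_loss !muln_gt0 q0 expn_gt0.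
have sum3 (F : X -> X -> X -> nat) :
    \sum_(p in setX (setX U U) U) F p.1.1 p.1.2 p.2 = \sum_(x in U) \sum_(y in U) \sum_(z in U) F x y z.
  rewrite (sum_setX _ _ (fun (p : X * X) z => F p.1 p.2 z)).
  by rewrite (sum_setX _ _ (fun x y => \sum_(z in U) F x y z)).
have [|V4 [sub4 c4 H4]] := @dense_common_nbrs q t _ _ (setX (setX U U) U) U (fun p => e p.1.1 p.1.2 p.2) q0 t0 s2.
  rewrite !cardsX (sum3 (fun x y z => \sum_(w in U) e x y z w)).
  by move: dense; rewrite expnSr !expnS expn0 muln1 mulnA.
rewrite !cardsX (sum3 (fun x y z => [forall w in V4, e x y z w] : nat)) in H4.
have [|V1 [V2 [V3 [[sub1 sub2 sub3] [c1 c2 c3 H]]]]] :=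
    HR X U (fun x y z => [forall w in V4, e x y z w]) s1 q10 t0.
  by move: H4; rewrite !expnS expn0 muln1 mulnA.
exists V1, V2, V3, V4; split=> //; split=> // x y z w x1 y2 z3.
by move/forall_inP: (H _ _ _ x1 y2 z3); apply.
Qed.

(** * Neighbourhoods in a 4-graph without PG_2(3) *)

(** A transposition and a 4-cycle generate all permutations, so [fg_neq] on the first two arguments
    makes all four distinct. *)
Record fourgraph (T : finType) (h : T -> T -> T -> T -> bool) : Prop := Fourgraph {
  fg_swap : forall x y z w, h x y z w = h y x z w;
  fg_rot : forall x y z w, h x y z w = h y z w x;
  fg_neq : forall x y z w, h x y z w -> x != y }.

(* [i], [p0], [p1], [p2] are the points of a line, i.e. the directions of the affine plane
   [a], in which [pm] carries the lines of slope [m] and [i] the vertical ones. *)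
Definition PG23_free (T : finType) (h : T -> T -> T -> T -> bool) : Prop :=
  forall i p0 p1 p2 a00 a01 a02 a10 a11 a12 a20 a21 a22 : T,
  h i p0 p1 p2 -> h i a00 a01 a02 -> h i a10 a11 a12 -> h i a20 a21 a22 ->
  h p0 a00 a10 a20 -> h p0 a01 a11 a21 -> h p0 a02 a12 a22 ->
  h p1 a00 a11 a22 -> h p1 a01 a12 a20 -> h p1 a02 a10 a21 ->
  h p2 a00 a12 a21 -> h p2 a01 a10 a22 -> h p2 a02 a11 a20 -> False.

Definition Nb (T : finType) (h : T -> T -> T -> T -> bool) x y z : {set T} :=
  [set w | h x y z w].

Definition codegree_half (T : finType) (h : T -> T -> T -> T -> bool) : Prop :=
  forall x y z, x != y -> y != z -> z != x -> #|T| <= 2 * #|Nb h x y z|.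

Definition NS (T : finType) (h : T -> T -> T -> T -> bool) (V : {set T}) : {set T} :=
  [set v | [exists x in V, [exists y in V, [exists z in V, h x y z v]]]].

Definition link_count (T : finType) (h : T -> T -> T -> T -> bool) (S : {set T}) v :=
  \sum_(x in S) \sum_(y in S) \sum_(z in S) h x y z v.

Lemma three_same_label (X Y : finType) (lab : X -> Y) (V : {set X}) (D : {set Y}) L :
  {in V, forall x, lab x \in D} -> #|D| <= L -> 2 * L < #|V| ->
  exists x y z, [/\ [/\ x \in V, y \in V & z \in V], [/\ x != y, y != z & z != x]
     & lab x = lab y /\ lab y = lab z].
Proof.
move=> labD cD cV.
have [||d dD Hd] := @pigeonhole_sum _ D (fun d => #|[set x in V | lab x == d]|) #|V| L cD.
- rewrite -sum1_card (partition_big lab (mem D)) //=.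
  apply: leq_sum => d _; rewrite -sum1_card.
  by rewrite [X in _ <= X](eq_bigl (fun x => (x \in V) && (lab x == d))) // => x; rewrite inE.
- by lia.
have /card_gt2P[x [y [z [[]]]]] : 2 < #|[set x in V | lab x == d]| by nia.
rewrite !inE => /andP[xV /eqP lx] /andP[yV /eqP ly] /andP[zV /eqP lz] D'.
by exists x, y, z; split=> //; rewrite lx ly lz.
Qed.

Lemma count_supersets (X : finType) (U W : {set X}) t :
  W \subset U -> #|[set V : {set X} | [&& V \subset U, #|V| == t & W \subset V]]|
     <= 'C(#|U| - #|W|, t - #|W|).
Proof.
move=> WU; have <- : #|U :\: W| = #|U| - #|W|.
  by rewrite cardsD (setIidPr WU).
rewrite -cards_draws -(@card_in_imset _ _ (fun V : {set X} => V :\: W)).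
  apply: subset_leq_card; apply/subsetP => V' /imsetP[V]; rewrite inE => /and3P[VU /eqP cV WV] ->.
  by rewrite inE setSD //= cardsD (setIidPr WV) cV.
move=> V1 V2; rewrite !inE => /and3P[_ _ W1] /and3P[_ _ W2] E.
by rewrite -(setID V1 W) -(setID V2 W) E (setIidPr W1) (setIidPr W2).
Qed.

(** The ratio of the two products is largest at [m = 3], where it is 27 / 6. *)
Lemma cube_le_falling m : 2 < m -> m ^ 3 <= 5 * (m * (m - 1) * (m - 2)).
Proof.
move=> m2; have [d ->] : exists d, m = d + 3 by exists (m - 3); lia.
have -> : d + 3 - 1 = d + 2 by lia.
have -> : d + 3 - 2 = d + 1 by lia.
by rewrite !expnS expn0; nia.
Qed.

(** Both sides count the pairs of a [t]-subset and an ordered triple of distinct elements in it. *)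
Lemma bin_falling3 m t : 2 < t -> t <= m ->
  m * (m - 1) * (m - 2) * 'C(m - 3, t - 3) = t * (t - 1) * (t - 2) * 'C(m, t).
Proof.
move=> t2 tm; have [a Ea] : exists a, t = a.+3 by exists (t - 3); lia.
have [b Eb] : exists b, m = b.+3 by exists (m - 3); lia.
have E1 := mul_bin_diag b.+3 a.+2; have E2 := mul_bin_diag b.+2 a.+1.
have E3 := mul_bin_diag b.+1 a.
rewrite Ea Eb !subSS !subn0; rewrite /= in E1 E2 E3.
move: ('C(b, a)) ('C(b.+1, a.+1)) ('C(b.+2, a.+2)) ('C(b.+3, a.+3)) E1 E2 E3 => c0 c1 c2 c3 E1 E2 E3.
have -> : b.+3 * b.+2 * b.+1 * c0 = b.+3 * (b.+2 * (b.+1 * c0)) by lia.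
have -> : a.+3 * a.+2 * a.+1 * c3 = a.+1 * (a.+2 * (a.+3 * c3)) by lia.
rewrite E3 -E1.
have -> : b.+3 * (b.+2 * (a.+1 * c1)) = a.+1 * (b.+3 * (b.+2 * c1)) by lia.
by rewrite E2; lia.
Qed.

Section Fourgraph.
Variables (T : finType) (h : T -> T -> T -> T -> bool).
Hypothesis fg : fourgraph h.
Let n := #|T|.
Notation N := (NS h).
Notation Nb := (Nb h).

Lemma h12 x y z w : h x y z w = h y x z w. Proof. exact: fg_swap fg _ _ _ _. Qed.
Lemma hrot x y z w : h x y z w = h y z w x. Proof. exact: fg_rot fg _ _ _ _. Qed.
Lemma h34 x y z w : h x y z w = h x y w z.
Proof. by rewrite hrot hrot h12 hrot hrot. Qed.
Lemma h23 x y z w : h x y z w = h x z y w.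
Proof. by rewrite hrot h12 hrot hrot hrot. Qed.

Lemma h_distinct x y z w : h x y z w ->
  [/\ x != y, y != z & z != x] /\ [/\ x != w, y != w & z != w].
Proof.
have ne a b c d : h a b c d -> a != b by exact: fg_neq fg _ _ _ _.
move=> H; split; split.
- exact: ne H.
- by move: H; rewrite hrot; exact: ne.
- by move: H; rewrite h23 h12; exact: ne.
- by move: H; rewrite h34 h23; exact: ne.
- by move: H; rewrite h12 h34 h23; exact: ne.
- by move: H; rewrite hrot hrot; exact: ne.
Qed.

Lemma NSP (V : {set T}) v :
  reflect (exists x y z, [/\ x \in V, y \in V, z \in V & h x y z v]) (v \in N V).
Proof.
rewrite inE; apply: (iffP exists_inP) => [[x xV /exists_inP[y yV /exists_inP[z zV H]]]|].
  by exists x, y, z.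
move=> [x [y [z [xV yV zV H]]]]; exists x => //; apply/exists_inP; exists y => //.
by apply/exists_inP; exists z.
Qed.

Lemma NS_mono (V U : {set T}) : V \subset U -> N V \subset N U.
Proof.
move=> /subsetP s; apply/subsetP => v /NSP[x [y [z [/s xV /s yV /s zV H]]]].
by apply/NSP; exists x, y, z.
Qed.

Lemma Nb_sub_NS x y z (V : {set T}) : x \in V -> y \in V -> z \in V -> Nb x y z \subset N V.
Proof.
by move=> xV yV zV; apply/subsetP => v; rewrite inE => H; apply/NSP; exists x, y, z.
Qed.

Hypothesis free : PG23_free h.

(** With [v], the triples it completes in the four parts become the four lines through [v]; the
    other nine lines are transversals of the parts. *)
Lemma complete_no_common_nbr (V1 V2 V3 V4 : {set T}) v :
  (forall x y z w, x \in V1 -> y \in V2 -> z \in V3 -> w \in V4 -> h x y z w) ->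
  v \in N V1 -> v \in N V2 -> v \in N V3 -> v \in N V4 -> False.
Proof.
move=> H /NSP[a00 [a01 [a02 [? ? ? Ha]]]] /NSP[a10 [a11 [a12 [? ? ? Hb]]]].
move=> /NSP[a20 [a21 [a22 [? ? ? Hc]]]] /NSP[p0 [p1 [p2 [? ? ? Hp]]]].
by apply: (free (i := v) (p0 := p0) (p1 := p1) (p2 := p2) (a00 := a00) (a01 := a01)
  (a02 := a02) (a10 := a10) (a11 := a11) (a12 := a12) (a20 := a20) (a21 := a21) (a22 := a22));
  rewrite 1?hrot //; apply: H.
Qed.

(* Along a tower of [k.+2] sizes the minimal density of [N U] cannot grow by [1 / k] at every step. *)
Lemma near_minimal_set (k : nat) (r : nat -> nat) :
  0 < k -> 0 < r 0 -> (forall i, r i <= r i.+1) -> r k.+1 <= n ->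
  exists i (U : {set T}), [/\ i <= k, #|U| = r i.+1 &
    forall V : {set T}, V \subset U -> #|V| = r i -> k * #|N U| <= k * #|N V| + n].
Proof.
move=> k0 r0 rS rn.
(* Without a stop before step [j], every set of size [r j] has a neighbourhood of at least
   [j * n / k] vertices, which is absurd at [j = k.+1]. *)
have key j : j <= k.+1 ->
   (exists i (U : {set T}), [/\ i < j, #|U| = r i.+1 &
     forall V : {set T}, V \subset U -> #|V| = r i -> k * #|N U| <= k * #|N V| + n])
   \/ (forall U : {set T}, #|U| = r j -> j * n <= k * #|N U|).
  elim: j => [|j IH] jk; first by right.
  case: (IH (ltnW jk)) => [[i [U [ij cU HU]]]|Hj].
    by left; exists i, U; split=> //; exact: ltnW.
  have [/existsP[U /andP[/eqP cU /forallP HU]]|/existsPn HU] := boolP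
    [exists U : {set T}, (#|U| == r j.+1) && [forall V : {set T},
       (V \subset U) ==> (#|V| == r j) ==> (k * #|N U| <= k * #|N V| + n)]].
    left; exists j, U; split=> // V VU /eqP cV.
    by move/implyP: (HU V) => /(_ VU) /implyP; apply.
  right=> U cU; move: (HU U); rewrite cU eqxx /= => /forallPn[V].
  rewrite !negb_imply => /and3P[VU /eqP cV]; have := Hj V cV; lia.
have [[i [U [ij cU HU]]]|H] := key k.+1 (leqnn _).
  by exists i, U; split.
have [|U _ cU] := @exists_card_subset T [set: T] (r k.+1); first by rewrite cardsT.
have := H U cU; have : #|N U| <= n by exact: max_card.
have : 0 < n; last by nia.
apply: leq_trans rn; elim: (k.+1) => // m; move: (rS m); lia.
Qed.

(* A sparse link on [U] is missed by the triples of at least half of the [t]-subsets of [U]. *)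
Lemma few_sparse_links k t (U : {set T}) : 2 < t -> t <= #|U| ->
  (forall V : {set T}, V \subset U -> #|V| = t -> k * #|N U| <= k * #|N V| + n) ->
  k * #|[set v in N U | 10 * t ^ 3 * link_count h U v < #|U| ^ 3]| <= 2 * n.
Proof.
move=> t2 tU HU; set P := [set v in _ | _].
pose D := [set V : {set T} | (V \subset U) && (#|V| == t)].
have cD : #|D| = 'C(#|U|, t) by rewrite cards_draws.
have C0 : 0 < #|D| by rewrite cD bin_gt0.
(* Each triple of the link on [U] lies in at most ['C(#|U| - 3, t - 3)] of the sets [V]. *)
have hit v : \sum_(V in D) (v \in N V) <= link_count h U v * 'C(#|U| - 3, t - 3).
  apply: (@leq_trans (\sum_(V in D) \sum_(x in U) \sum_(y in U) \sum_(z in U)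
            [&& h x y z v, x \in V, y \in V & z \in V])).
    apply: leq_sum => V; rewrite inE => /andP[/subsetP VU _].
    case: NSP => // -[x [y [z [xV yV zV H]]]].
    rewrite (bigD1 x) ?VU //= (bigD1 y) ?VU //= (bigD1 z) ?VU //=.
    by rewrite H xV yV zV.
  rewrite exchange_big big_distrl /=; apply: leq_sum => x xU.
  rewrite exchange_big big_distrl /=; apply: leq_sum => y yU.
  rewrite exchange_big big_distrl /=; apply: leq_sum => z zU.
  have [H|] := boolP (h x y z v); last by rewrite big1.
  have [[xy yz zx] _] := h_distinct H.
  have c3 : #|[set x; y; z]| = 3.
    by rewrite setUC cardsU1 cards2 !inE xy negb_or zx eq_sym yz.
  have sub : [set x; y; z] \subset U.
    by apply/subsetP => u; rewrite !inE => /orP[/orP[]|] /eqP->.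
  rewrite mul1n -[in X in _ <= X]c3; apply: leq_trans (count_supersets t sub).
  rewrite -sum1_card big_mkcond [X in _ <= X]big_mkcond /=; apply: leq_sum => V _.
  rewrite !inE; case: (V \subset U) => //=; case: (#|V| == t) => //=.
  case: and3P => // -[xV yV zV].
  suff -> : [set x; y; z] \subset V by [].
  by apply/subsetP => u; rewrite !inE => /orP[/orP[]|] /eqP->.
(* The constant 10 is twice the 5 of [cube_le_falling]: a sparse link is hit by at most half of the
   sets [V]. *)
have miss v : v \in P -> #|D| <= 2 * \sum_(V in D) (v \notin N V).
  rewrite inE => /andP[_ poor].
  have E : \sum_(V in D) (v \in N V) + \sum_(V in D) (v \notin N V) = #|D|.
    by rewrite -big_split -sum1_card; apply: eq_bigr => V _; case: (v \in N V).
  have h1 := hit v; have h2 := cube_le_falling (leq_trans t2 tU).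
  have h3 := bin_falling3 t2 tU; rewrite -cD in h3.
  have h4 : t * (t - 1) * (t - 2) <= t ^ 3.
    by rewrite !expnS expn0 muln1 mulnA !leq_mul // leq_subr.
  have C'0 : 0 < 'C(#|U| - 3, t - 3) by rewrite bin_gt0; lia.
  have t30 : 0 < t ^ 3 by rewrite expn_gt0; lia.
  move: (link_count h U v) ('C(#|U| - 3, t - 3)) (t ^ 3) (#|U| ^ 3) (#|D|)
    (#|U| * (#|U| - 1) * (#|U| - 2)) (t * (t - 1) * (t - 2)) poor h1 h2 h3 h4 C'0 t30 E
    => e c t3 u3 d fu ft poor h1 h2 h3 h4 c0 t30 E.
  have : 10 * t3 * e * c < u3 * c by rewrite ltn_pmul2r.
  have : u3 * c <= 5 * (ft * d) by rewrite -h3; nia.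
  have : ft * d <= t3 * d by rewrite leq_mul2r h4 orbT.
  move=> g1 g2 g3.
  have : t3 * (10 * (e * c)) < t3 * (5 * d) by nia.
  by rewrite ltn_pmul2l //; lia.
have tot : k * \sum_(V in D) #|N U :\: N V| <= n * #|D|.
  rewrite big_distrr /= mulnC -sum_nat_const; apply: leq_sum => V; rewrite inE => /andP[VU /eqP cV].
  rewrite cardsD (setIidPr (NS_mono VU)) mulnBr; have := HU V VU cV; lia.
have : \sum_(v in P) \sum_(V in D) (v \notin N V) <= \sum_(V in D) #|N U :\: N V|.
  rewrite exchange_big; apply: leq_sum => V _ /=.
  rewrite -sum1_card big_mkcond [X in _ <= X]big_mkcond; apply: leq_sum => v _.
  by rewrite !inE; case: [exists x in U, _]; case: [exists x in V, _] => //=; case: (_ < _).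
have : #|P| * #|D| <= 2 * \sum_(v in P) \sum_(V in D) (v \notin N V).
  by rewrite big_distrr /= -sum_nat_const; apply: leq_sum => v /miss.
move: (\sum_(v in P) _) (\sum_(V in D) _) tot => a b; move: #|P| #|D| C0 => p d d0 h1 h2 h3.
rewrite -(leq_pmul2r d0).
apply: (@leq_trans (k * (2 * b))); last by lia.
by rewrite -mulnA leq_mul2l; apply/orP; right; lia.
Qed.

End Fourgraph.

Definition missing (T : finType) (h : T -> T -> T -> T -> bool) (S S' : {set T}) :=
  \sum_(x in S) \sum_(y in S) \sum_(z in S) \sum_(w in S') ~~ h x y z w.

Definition distinct3 (T : eqType) (x y z : T) := [&& x != y, y != z & z != x].

Lemma sum_mem_card (T : finType) (A : {set T}) (P : pred T) :
  \sum_(x in A) P x = #|[set x in A | P x]|.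
Proof.
rewrite -sum1_card big_mkcond [RHS]big_mkcond; apply: eq_bigr => x _.
by rewrite inE; case: (x \in A); case: (P x).
Qed.

Lemma sum_eq_mem (T : finType) (A : {set T}) a : \sum_(z in A) (z == a) = (a \in A).
Proof.
have [aA|aA] := boolP (a \in A).
  by rewrite (bigD1 a) //= eqxx big1 // => z /andP[_ /negPf->].
by rewrite big1 // => z zA; case: eqP zA aA => // -> ->.
Qed.

Lemma sum_distinct3 (T : finType) (A : {set T}) :
  \sum_(x in A) \sum_(y in A) \sum_(z in A) distinct3 x y z = #|A| * (#|A| - 1) * (#|A| - 2).
Proof.
have E x y : x \in A -> y \in A -> \sum_(z in A) distinct3 x y z = (x != y) * (#|A| - 2).
  move=> xA yA; rewrite sum_mem_card; have [->|xy] := eqVneq x y.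
    rewrite mul0n; apply/eqP; rewrite cards_eq0; apply/eqP/setP => z.
    by rewrite !inE /distinct3 eqxx andbF.
  rewrite mul1n -[#|A|](cardsID [set x; y]) (setIidPr _); last first.
    by apply/subsetP => u; rewrite !inE => /orP[]/eqP->.
  rewrite cards2 xy addKn; apply: eq_card => z.
  by rewrite !inE /distinct3 xy negb_or /= [y == z]eq_sym andbC; case: (z == x); case: (z == y).
have F x : x \in A -> \sum_(y in A) \sum_(z in A) distinct3 x y z = (#|A| - 1) * (#|A| - 2).
  move=> xA; rewrite (eq_bigr (fun y => (x != y) * (#|A| - 2))); last by move=> y yA; exact: E.
  rewrite -big_distrl sum_mem_card /=; congr (_ * _).
  rewrite [in RHS](cardsD1 x) xA addKn; apply: eq_card => y.
  by rewrite !inE eq_sym andbC.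
by rewrite (eq_bigr _ F) sum_nat_const mulnA.
Qed.

Lemma sum_not_distinct3 (T : finType) (A : {set T}) :
  \sum_(x in A) \sum_(y in A) \sum_(z in A) ~~ distinct3 x y z <= 3 * #|A| ^ 2.
Proof.
apply: (@leq_trans (\sum_(x in A) \sum_(y in A) \sum_(z in A) ((y == x) + (z == y) + (z == x)))).
  apply: leq_sum => x _; apply: leq_sum => y _; apply: leq_sum => z _.
  rewrite /distinct3 [x == y]eq_sym [y == z]eq_sym.
  by case: (y == x); case: (z == y); case: (z == x).
rewrite (eq_bigr (fun=> 3 * #|A|)); first by rewrite sum_nat_const; lia.
move=> x xA; rewrite (eq_bigr (fun y => #|A| * (y == x) + 2)).
  by rewrite big_split /= -big_distrr /= sum_eq_mem xA sum_nat_const; lia.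
by move=> y yA; rewrite !big_split /= !sum_eq_mem xA yA sum_nat_const; lia.
Qed.

Lemma card_setU3_le (T : finType) (A B C : {set T}) : #|A :|: B :|: C| <= #|A| + #|B| + #|C|.
Proof.
by apply: leq_trans (leq_card_setU _ _) _; rewrite leq_add2r; exact: leq_card_setU.
Qed.

Lemma card_setU4_le (T : finType) (A B C D : {set T}) :
  #|A :|: B :|: C :|: D| <= #|A| + #|B| + #|C| + #|D|.
Proof.
by apply: leq_trans (leq_card_setU _ _) _; rewrite leq_add2r; exact: card_setU3_le.
Qed.

(* In a complete 4-partite graph with large parts each part contains a monochromatic triple; the
   neighbourhoods of these four triples would then have a common vertex in [M]. *)
Lemma sparse_of_labels L q : exists R, forall (T : finType) (h : T -> T -> T -> T -> bool),
  fourgraph h -> PG23_free h ->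
  forall (B M : {set T}) (Y : finType) (lab : T -> Y) (D : {set Y}),
  {in B, forall x, lab x \in D} -> #|D| <= L ->
  (forall x y z, x \in B -> y \in B -> z \in B -> distinct3 x y z ->
     lab x = lab y -> lab y = lab z -> 4 * #|M :\: Nb h x y z| < #|M|) ->
  R <= #|B| -> 0 < q ->
  q * \sum_(x in B) \sum_(y in B) \sum_(z in B) \sum_(w in B) h x y z w < #|B| ^ 4.
Proof.
(* Among [(2 * L).+1] vertices with at most [L] labels, three have the same label. *)
have [R HR] := complete_fourpartite q (2 * L).+1.
exists R => T h fg free B M Y lab D labD cD HM RB q0.
rewrite ltnNge; apply/negP => dense.
have [V1 [V2 [V3 [V4 [[s1 s2 s3 s4] [c1 c2 c3 c4 H]]]]]] := HR _ B h RB q0 isT dense.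
have pick (V : {set T}) : V \subset B -> #|V| = (2 * L).+1 ->
    exists x y z, [/\ x \in V, y \in V, z \in V & 4 * #|M :\: Nb h x y z| < #|M|].
  move=> /subsetP VB cV.
  have [||x [y [z [[xV yV zV] [xy yz zx] [l1 l2]]]]] := @three_same_label _ _ lab V D L _ cD.
  - by move=> x /VB /labD.
  - by rewrite cV.
  exists x, y, z; split=> //; apply: HM; rewrite ?VB //.
  by rewrite /distinct3 xy yz zx.
have [x1 [y1 [z1 [? ? ? m1]]]] := pick _ s1 c1; have [x2 [y2 [z2 [? ? ? m2]]]] := pick _ s2 c2.
have [x3 [y3 [z3 [? ? ? m3]]]] := pick _ s3 c3; have [x4 [y4 [z4 [? ? ? m4]]]] := pick _ s4 c4.
(* Each of the four triples misses less than a quarter of [M], so some vertex of [M] is missed by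
   none. *)
have [MS|/subsetPn[v vM]] := boolP (M \subset (M :\: Nb h x1 y1 z1) :|: (M :\: Nb h x2 y2 z2)
   :|: (M :\: Nb h x3 y3 z3) :|: (M :\: Nb h x4 y4 z4)).
  have := leq_trans (subset_leq_card MS) (card_setU4_le _ _ _ _).
  move: m1 m2 m3 m4; clear; lia.
rewrite !in_setU !in_setD vM !andbT !negb_or !negbK => /andP[/andP[/andP[v1 v2] v3] v4].
apply: (complete_no_common_nbr fg free (v := v) H).
- by apply: (subsetP (Nb_sub_NS h _ _ _)) v1.
- by apply: (subsetP (Nb_sub_NS h _ _ _)) v2.
- by apply: (subsetP (Nb_sub_NS h _ _ _)) v3.
- by apply: (subsetP (Nb_sub_NS h _ _ _)) v4.
Qed.

(** * Labelling vertices by complete tripartite pieces of their links *)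

Section Labels.
Variables (T : finType) (h : T -> T -> T -> T -> bool).
Hypotheses (fg : fourgraph h) (free : PG23_free h).
Let n := #|T|.
Notation N := (NS h).

Definition complete_to t (U : {set T}) v (V : {set T} * {set T} * {set T}) :=
  [&& [&& V.1.1 \subset U, V.1.2 \subset U & V.2 \subset U],
      [&& #|V.1.1| == t, #|V.1.2| == t & #|V.2| == t] &
      [forall x in V.1.1, [forall y in V.1.2, [forall z in V.2, h x y z v]]]].

Definition rich_set t (U : {set T}) := [set v | [exists V, complete_to t U v V]].

(* The default [(set0, set0, set0)] is only taken outside [rich_set]. *)
Definition clique_label t (U : {set T}) v : {set T} * {set T} * {set T} :=
  odflt (set0, set0, set0) [pick V | complete_to t U v V].

Definition clique_labels (U : {set T}) := setX (setX (powerset U) (powerset U)) (powerset U).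

Lemma card_clique_labels U : #|clique_labels U| = (2 ^ #|U|) ^ 3.
Proof. by rewrite !cardsX card_powerset !expnS expn0 muln1 mulnA. Qed.

Lemma clique_label_mem t U v : clique_label t U v \in clique_labels U.
Proof.
rewrite /clique_label; case: pickP => [V /and3P[/and3P[? ? ?] _ _]|_] /=.
  by rewrite !inE; apply/andP; split=> //; apply/andP.
by rewrite !inE !sub0set.
Qed.

Lemma clique_labelP t U v : v \in rich_set t U -> complete_to t U v (clique_label t U v).
Proof.
rewrite inE /clique_label => /existsP[V HV]; case: pickP => //= none.
by move: HV; rewrite none.
Qed.

(** The common label and [[set x; y; z]] span a complete 4-partite subgraph, so
    [complete_no_common_nbr] applies. *)
Lemma same_clique_label t U x y z :
  x \in rich_set t U -> y \in rich_set t U -> z \in rich_set t U ->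
  clique_label t U x = clique_label t U y -> clique_label t U y = clique_label t U z ->
  exists V1 V2 V3 : {set T}, [/\ [/\ V1 \subset U, V2 \subset U & V3 \subset U],
    [/\ #|V1| = t, #|V2| = t & #|V3| = t] &
    forall v, v \in Nb h x y z -> v \in N V1 -> v \in N V2 -> v \in N V3 -> False].
Proof.
move=> /clique_labelP Hx /clique_labelP Hy /clique_labelP Hz l1 l2.
move: Hx Hy Hz; rewrite -l2 l1; case: (clique_label t U y) => [[V1 V2] V3] /=.
move=> /and3P[/and3P[/= s1 s2 s3] /and3P[/eqP c1 /eqP c2 /eqP c3] Hx].
move=> /and3P[_ _ Hy] /and3P[_ _ Hz].
exists V1, V2, V3; split=> // v vN v1 v2 v3.
have vS : v \in N [set x; y; z].
  by apply: (subsetP (Nb_sub_NS h _ _ _)) vN; rewrite !inE eqxx ?orbT.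
apply: (complete_no_common_nbr fg free _ v1 v2 v3 vS) => a b c w aV bV cV.
by rewrite !inE => /orP[/orP[]|] /eqP->;
  [move: Hx|move: Hy|move: Hz] => /forall_inP/(_ _ aV)/forall_inP/(_ _ bV)/forall_inP; apply.
Qed.

(** A triple of [A] has at least [n / 2] neighbours, and at most [n / 2 + 9 * n / k] vertices lie
    outside [A]; so it misses at most [9 * n / k] vertices of [B] beyond the number of its
    neighbours in [A]. The factor 11 is 9 for this slack, 1 for the 4-sets inside [A] and 1 for
    triples with a repetition. *)
Lemma missing_le k (A B : {set T}) : codegree_half h -> [disjoint A & B] ->
  k * n <= 2 * k * #|A| + 18 * n -> 3 * k <= n ->
  k * \sum_(x in A) \sum_(y in A) \sum_(z in A) \sum_(w in A) h x y z w <= n ^ 4 ->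
  k * missing h A B <= 11 * n ^ 4.
Proof.
move=> cod dAB kA kn sparse.
have An : #|A| <= n by exact: max_card.
have step x y z : k * \sum_(w in B) ~~ h x y z w <=
    k * \sum_(w in A) h x y z w + 9 * n + k * n * ~~ distinct3 x y z.
  have -> : \sum_(w in B) ~~ h x y z w = #|B :\: Nb h x y z|.
    by rewrite sum_mem_card; apply: eq_card => w; rewrite !inE andbC.
  have -> : \sum_(w in A) h x y z w = #|A :&: Nb h x y z|.
    by rewrite sum_mem_card; apply: eq_card => w; rewrite !inE.
  have [/and3P[xy yz zx]|_] := boolP (distinct3 x y z); last first.
    have : #|B :\: Nb h x y z| <= n by exact: max_card.
    by move=> ?; rewrite muln1; apply: leq_trans (leq_addl _ _); rewrite leq_mul2l; apply/orP; right.
  rewrite muln0 addn0; have := cod _ _ _ xy yz zx; rewrite -/n.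
  set P := Nb h x y z; have e1 := cardsID P A; have e2 := cardsID P B.
  have e3 : #|A :|: B| = #|A| + #|B| by rewrite cardsU (disjoint_setI0 dAB) cards0 subn0.
  have e4 : #|A :|: B :|: P| <= n by exact: max_card.
  have e5 : #|P :&: (A :|: B)| = #|A :&: P| + #|B :&: P|.
    rewrite setIUr [P :&: A]setIC [P :&: B]setIC cardsU [X in _ - X](_ : _ = 0) ?subn0 //.
    apply/eqP; rewrite cards_eq0 setIACA setIid (disjoint_setI0 dAB) set0I //.
  have e6 := cardsUI (A :|: B) P; rewrite setIC e5 e3 in e6.
  move=> cP; have e7 : 2 * #|B :\: P| + 2 * #|A| <= 2 * #|A :&: P| + n by lia.
  have : k * (2 * #|B :\: P| + 2 * #|A|) <= k * (2 * #|A :&: P| + n) by rewrite leq_mul2l e7 orbT.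
  by rewrite !mulnDr; lia.
have : k * missing h A B <= \sum_(x in A) \sum_(y in A) \sum_(z in A)
    (k * \sum_(w in A) h x y z w + 9 * n + k * n * ~~ distinct3 x y z).
  rewrite /missing !big_distrr; apply: leq_sum => x _ /=.
  rewrite !big_distrr; apply: leq_sum => y _ /=.
  by rewrite !big_distrr; apply: leq_sum => z _; exact: step.
move/leq_trans; apply.
have -> : \sum_(x in A) \sum_(y in A) \sum_(z in A)
    (k * \sum_(w in A) h x y z w + 9 * n + k * n * ~~ distinct3 x y z) =
  k * (\sum_(x in A) \sum_(y in A) \sum_(z in A) \sum_(w in A) h x y z w) +
  9 * n * #|A| ^ 3 + k * n * \sum_(x in A) \sum_(y in A) \sum_(z in A) ~~ distinct3 x y z.
  have -> : 9 * n * #|A| ^ 3 = \sum_(x in A) \sum_(y in A) \sum_(z in A) 9 * n.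
    by rewrite !sum_nat_const !expnS expn0; lia.
  rewrite !big_distrr -!big_split; apply: eq_bigr => x _ /=.
  rewrite !big_distrr -!big_split; apply: eq_bigr => y _ /=.
  by rewrite !big_distrr -!big_split; apply: eq_bigr => z _ /=.
have a3 : n * #|A| ^ 3 <= n ^ 4 by rewrite [X in _ <= X]expnS leq_mul2l leq_exp2r ?An ?orbT.
have nd := sum_not_distinct3 A.
have a2 : k * n * (3 * #|A| ^ 2) <= n ^ 4.
  have : #|A| ^ 2 <= n ^ 2 by rewrite leq_exp2r.
  have -> : n ^ 4 = n * n * n ^ 2 by rewrite !expnS expn0; lia.
  have -> : k * n * (3 * #|A| ^ 2) = (3 * k) * n * #|A| ^ 2 by lia.
  by move=> ?; rewrite !leq_mul.
have : k * n * \sum_(x in A) \sum_(y in A) \sum_(z in A) ~~ distinct3 x y z <= n ^ 4.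
  by apply: leq_trans a2; rewrite leq_mul2l nd orbT.
lia.
Qed.

End Labels.

(** * Construction of the almost parity partition *)

Lemma exists_tower (P : nat -> nat -> Prop) : (forall t, exists R, t <= R /\ P t R) ->
  forall j, exists r : nat -> nat, [/\ r 0 = 3, forall i, r i <= r i.+1 &
    forall i, i < j -> P (r i) (r i.+1)].
Proof.
move=> HP; elim=> [|j [r [r0 rS Hr]]]; first by exists (fun=> 3).
have [R [leR PR]] := HP (r j).
exists (fun i => if i <= j then r i else R); split=> // [i|i].
  case: (ltnP i j) => [/ltnW->|ji]; first exact: rS.
  by case: (leqP i j) => // ij; have -> : i = j by lia.
rewrite ltnS => ij; rewrite ij; case: ltnP => [/Hr //|ji].
by have -> : i = j by lia.
Qed.

Lemma monotone_seq (r : nat -> nat) : (forall i, r i <= r i.+1) -> forall i j, i <= j -> r i <= r j.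
Proof.
move=> rS i j /subnKC <-; elim: (j - i) => [|d IH]; first by rewrite addn0.
by rewrite addnS; exact: leq_trans IH (rS _).
Qed.

(** For a triple with [p] neighbours, [ps] of them in a set of size [s] and [pc] outside,
    [sp = s - p + pc] counts the vertices it misses in the set. Here [s] exceeds [p] by at most
    [3 * n / K], and [pc] is at most [9 * n / K]. *)
Lemma deficit_le K n p ps pc s sp b c e : pc <= b + c + e -> K * b <= 3 * n -> K * c <= 3 * n ->
  K * e <= 3 * n -> n <= 2 * p -> ps + sp = s -> ps + pc = p -> 2 * K * s <= K * n + 6 * n ->
  K * sp <= 12 * n.
Proof.
move=> le hb hc he np <- Ep; rewrite -Ep in np; rewrite mulnDr.
have : K * pc <= K * b + K * c + K * e by rewrite -!mulnDr leq_mul2l le orbT.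
have : K * n <= 2 * (K * ps) + 2 * (K * pc) by rewrite -mulnDr -mulnDr mulnCA leq_mul2l np orbT.
by lia.
Qed.

Section Partition.
Variables (T : finType) (h : T -> T -> T -> T -> bool).
Hypotheses (fg : fourgraph h) (free : PG23_free h) (cod : codegree_half h).
Let n := #|T|.
Notation N := (NS h).

Lemma dense_rich q t R (U : {set T}) v :
  tripartite_bound q t R ->
  R <= #|U| -> 0 < q -> 0 < t -> #|U| ^ 3 <= q * link_count h U v -> v \in rich_set h t U.
Proof.
move=> HR RU q0 t0 /(HR _ _ (fun x y z => h x y z v) RU q0 t0).
move=> [V1 [V2 [V3 [[s1 s2 s3] [c1 c2 c3 H]]]]].
rewrite inE; apply/existsP; exists (V1, V2, V3).
rewrite /complete_to /= s1 s2 s3 c1 c2 c3 eqxx /=.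
apply/forall_inP => x xV; apply/forall_inP => y yV; apply/forall_inP => z zV; exact: H.
Qed.

(** Two sets of at least half of the vertices leave no more vertices outside their union than they
    share. *)
Lemma card_Nb_outside k c (S P : {set T}) : n <= 2 * #|P| -> n <= 2 * #|S| ->
  k * #|P :&: S| <= c * n -> k * #|~: S :\: P| <= c * n.
Proof.
move=> P2 S2 PS; have e1 := cardsID S P; have e2 := cardsID P (~: S).
have e3 := cardsC S; rewrite [~: S :&: P]setIC -setDE in e2.
by apply: leq_trans PS; rewrite leq_mul2l; apply/orP; right; rewrite -/n in e3; lia.
Qed.

(** A vertex outside [rich_set] has a sparse link on [U], so at least half of the triples of
    distinct vertices of [U] miss it, while each such triple misses few vertices of [S]. *)
Lemma few_poor_vertices k R (U S : {set T}) : 2 < #|U| -> R <= #|U| ->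
  tripartite_bound 10 3 R ->
  (forall x y z, x \in U -> y \in U -> z \in U -> distinct3 x y z -> k * #|S :\: Nb h x y z| <= 3 * n) ->
  k * #|S :\: rich_set h 3 U| <= 6 * n.
Proof.
move=> U2 RU HR HU; pose P := S :\: rich_set h 3 U.
pose f := #|U| * (#|U| - 1) * (#|U| - 2).
pose miss v := \sum_(x in U) \sum_(y in U) \sum_(z in U) (distinct3 x y z && ~~ h x y z v).
have f0 : 0 < f by rewrite /f !muln_gt0; lia.
have poor v : v \in P -> f <= 2 * miss v.
  rewrite inE => /andP[nr _].
  have : 10 * link_count h U v < #|U| ^ 3.
    by rewrite ltnNge; apply/negP => H; move/negP: nr; apply; exact: dense_rich HR RU _ _ H.
  have := cube_le_falling U2; rewrite -/f.
  have : link_count h U v + miss v = f.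
    rewrite /f -sum_distinct3 /link_count /miss -big_split; apply: eq_bigr => x _ /=.
    rewrite -big_split; apply: eq_bigr => y _ /=; rewrite -big_split; apply: eq_bigr => z _ /=.
    have [H|] := boolP (h x y z v); last by rewrite andbT.
    by have [[d1 d2 d3] _] := h_distinct fg H; rewrite /distinct3 d1 d2 d3.
  by lia.
have H1 : #|P| * f <= 2 * \sum_(v in S) miss v.
  rewrite big_distrr /= -sum_nat_const big_mkcond [X in _ <= X]big_mkcond; apply: leq_sum => v _.
  case: ifP => [vP|//]; move: (vP); rewrite inE => /andP[_ ->]; exact: poor.
have H2 : k * \sum_(v in S) miss v <= f * (3 * n).
  rewrite /miss exchange_big /f -sum_distinct3 big_distrr big_distrl; apply: leq_sum => x xU /=.
  rewrite exchange_big big_distrr big_distrl; apply: leq_sum => y yU /=.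
  rewrite exchange_big big_distrr big_distrl; apply: leq_sum => z zU /=.
  have [d|_] := boolP (distinct3 x y z); last by rewrite big1 // muln0.
  rewrite mul1n sum_mem_card; apply: leq_trans (HU x y z xU yU zU d).
  by rewrite leq_mul2l; apply/orP; right; apply: subset_leq_card; apply/subsetP => w; rewrite !inE andbC.
rewrite -(leq_pmul2r f0); move: #|P| (\sum_(v in S) miss v) H1 H2 => p s H1 H2.
apply: (@leq_trans (k * (2 * s))); last by lia.
by rewrite -mulnA leq_mul2l H1 orbT.
Qed.

End Partition.

(* [U'] below lies in one label class of [B], so that its triples see nearly all of the complement
   of [N U]; playing the role of [U], it yields the part [A]. *)
Lemma almost_parity_partition k : 0 < k -> exists n0, forall (T : finType) (h : T -> T -> T -> T -> bool),
  fourgraph h -> PG23_free h -> codegree_half h -> n0 <= #|T| ->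
  exists A B : {set T}, [/\ [disjoint A & B], 2 * #|T| <= 5 * #|A|, 2 * #|T| <= 5 * #|B|,
    k * missing h A B <= #|T| ^ 4 & k * missing h B A <= #|T| ^ 4].
Proof.
(* The factor 11 is the loss in [missing_le]; the summand 100 keeps all errors of order [n / K]
   small against [n]. *)
move=> k0; pose K := 11 * k + 100.
have KE : K = 11 * k + 100 by [].
(* This density is the threshold of [few_sparse_links]: a link on [r i.+1] vertices that reaches it
   has a complete tripartite piece with parts of size [r i]. *)
pose P t R := tripartite_bound (10 * t ^ 3) t R.
have stepP t : exists R, t <= R /\ P t R.
  have [R HR] := complete_tripartite (10 * t ^ 3) t.
  exists (maxn t R); rewrite leq_maxl; split=> // X U e RU.
  by apply: HR; apply: leq_trans RU; exact: leq_maxr.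
have [r [r0 rS Hr]] := exists_tower stepP K.+1.
have [R HR] := complete_tripartite 10 3.
pose R' := maxn R 3.
pose L1 := (2 ^ r K.+1) ^ 3; pose L2 := (2 ^ R') ^ 3.
have [R1 HR1] := sparse_of_labels L1 K; have [R2 HR2] := sparse_of_labels L2 K.
(* The summands serve the tower, a label class of [R'] vertices among [L1] labels, and the two uses
   of [sparse_of_labels]. *)
pose m0 := r K.+1 + R' * L1 + R1 + R2.
exists (5 * m0 + 3 * K + 1) => T h fg free cod; set n := #|T| => nn0.
have [|||i [U [iK cU HU]]] := near_minimal_set h (k := K) (r := r) _ _ rS.
- by rewrite KE; lia.
- by rewrite r0.
- by rewrite -/n; lia.
set t := r i in HU.
have t2 : 2 < t by rewrite -r0; apply: monotone_seq.
have tU : t <= #|U| by rewrite cU; exact: rS.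
set S := NS h U; pose B := S :&: rich_set h t U.
have cB : K * #|S :\: B| <= 2 * n.
  apply: leq_trans (few_sparse_links fg t2 tU HU); rewrite leq_mul2l; apply/orP; right.
  apply: subset_leq_card; apply/subsetP => v; rewrite in_setD in_setI => /andP[nB vS].
  rewrite vS /= in nB; rewrite inE vS /= ltnNge; apply/negP => H; move/negP: nB; apply.
  apply: dense_rich (Hr i _) _ _ _ H; rewrite ?cU //; lia.
have U2 : 2 < #|U| by lia.
have S2 : n <= 2 * #|S|.
  have /card_gt2P[x [y [z [[xU yU zU] [xy yz zx]]]]] := U2.
  apply: leq_trans (cod _ _ _ xy yz zx) _; rewrite leq_mul2l /=.
  exact: subset_leq_card (Nb_sub_NS h xU yU zU).
(* The neighbourhood of each part of the common label covers nearly all of [S], and no neighbour of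
   the triple lies in all three. *)
have NbB x y z : x \in B -> y \in B -> z \in B ->
    clique_label h t U x = clique_label h t U y -> clique_label h t U y = clique_label h t U z ->
    K * #|Nb h x y z :&: S| <= 3 * n.
  rewrite !in_setI => /andP[_ xr] /andP[_ yr] /andP[_ zr] l1 l2.
  have [V1 [V2 [V3 [[s1 s2 s3] [c1 c2 c3] H]]]] := same_clique_label fg free xr yr zr l1 l2.
  have near (V : {set T}) : V \subset U -> #|V| = t -> K * #|S :\: NS h V| <= n.
    move=> s c; rewrite cardsD (setIidPr (NS_mono _ s)) mulnBr; have := HU V s c; rewrite -/n -/S; lia.
  have sub : Nb h x y z :&: S \subset (S :\: NS h V1) :|: (S :\: NS h V2) :|: (S :\: NS h V3).
    apply/subsetP => v; rewrite in_setI => /andP[vN vS]; rewrite !in_setU !in_setD vS !andbT.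
    by rewrite -!negb_and; apply/negP => /andP[/andP[v1 v2] v3]; exact: H v vN v1 v2 v3.
  have := leq_trans (subset_leq_card sub) (card_setU3_le _ _ _).
  have := near _ s1 c1; have := near _ s2 c2; have := near _ s3 c3.
  move: #|_ :&: S| #|_ :\: NS h V1| #|_ :\: NS h V2| #|_ :\: NS h V3| => a b c d; clear; nia.
have NbBc x y z : x \in B -> y \in B -> z \in B -> distinct3 x y z ->
    clique_label h t U x = clique_label h t U y -> clique_label h t U y = clique_label h t U z ->
    K * #|~: S :\: Nb h x y z| <= 3 * n.
  move=> xB yB zB /and3P[xy yz zx] l1 l2.
  by apply: card_Nb_outside (cod _ _ _ xy yz zx) S2 (NbB _ _ _ xB yB zB l1 l2).
have cSB : #|S| = #|B| + #|S :\: B|.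
  by rewrite -[#|S|](cardsID B) setIA setIid.
have cBm : 2 * n <= 5 * #|B| by rewrite KE in cB; nia.
have L1B : #|clique_labels U| <= L1.
  by rewrite card_clique_labels leq_exp2r // leq_exp2l // cU; apply: monotone_seq rS _ _ _; lia.
have [||d dD Hd] := @pigeonhole_sum _ (clique_labels U) (fun d => #|[set x in B | clique_label h t U x == d]|) #|B| L1 L1B.
- rewrite -sum1_card (partition_big (clique_label h t U) (mem (clique_labels U))) /=; last first.
    by move=> x _; exact: clique_label_mem.
  apply: leq_sum => d _; rewrite -sum1_card.
  by rewrite [X in _ <= X](eq_bigl (fun x => (x \in B) && (clique_label h t U x == d))) // => x; rewrite inE.
- by lia.
have [|U' sU' cU'] := @exists_card_subset _ [set x in B | clique_label h t U x == d] R'.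
  have L10 : 0 < L1 by rewrite /L1 !expn_gt0.
  by rewrite -(leq_pmul2l L10); move: Hd; rewrite /m0 in nn0; lia.
have inU' x : x \in U' -> x \in B /\ clique_label h t U x = d.
  by move/(subsetP sU'); rewrite inE => /andP[? /eqP].
have NbU' x y z : x \in U' -> y \in U' -> z \in U' -> distinct3 x y z -> K * #|~: S :\: Nb h x y z| <= 3 * n.
  move=> /inU'[xB lx] /inU'[yB ly] /inU'[zB lz] dis.
  by apply: NbBc dis _ _; rewrite ?lx ?ly ?lz.
have U'2 : 2 < #|U'| by rewrite cU' leq_maxr.
pose A := ~: S :&: rich_set h 3 U'.
have cA : K * #|~: S :\: A| <= 6 * n.
  have -> : ~: S :\: A = ~: S :\: rich_set h 3 U'.
    by apply/setP => v; rewrite !inE; case: [exists x in U, _]; rewrite ?andbF.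
  by apply: few_poor_vertices U'2 _ HR NbU'; rewrite // cU' leq_maxl.
(* A triple of [U'] has at least [n / 2] neighbours, nearly all outside [S]; so [S] has hardly more
   than [n / 2] vertices. *)
have S2' : 2 * K * #|S| <= K * n + 6 * n.
  have /card_gt2P[x [y [z [[/inU'[xB lx] /inU'[yB ly] /inU'[zB lz]] [xy yz zx]]]]] := U'2.
  have h1 : K * #|Nb h x y z :&: S| <= 3 * n by apply: NbB; rewrite ?lx ?ly ?lz.
  have h2 := cod _ _ _ xy yz zx; rewrite -/n in h2.
  have h3 := cardsUI (Nb h x y z) S.
  have h4 : #|Nb h x y z :|: S| <= n by exact: max_card.
  move: #|Nb h x y z| #|_ :&: S| #|_ :|: S| #|S| h1 h2 h3 h4 => a b c s h1 h2 h3 h4.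
  have le : 2 * s + n <= 2 * n + 2 * b by move: h2 h3 h4; clear; lia.
  have : K * (2 * s + n) <= K * (2 * n + 2 * b) by rewrite leq_mul2l le orbT.
  by rewrite !mulnDr; move: h1; clear; lia.
(* The argument for [NbB] with [U'] and [~: S] for [U] and [S] leaves few neighbours outside [S]; by
   [S2'] nearly all of [S] is then needed. *)
have NbA x y z : x \in A -> y \in A -> z \in A -> distinct3 x y z ->
    clique_label h 3 U' x = clique_label h 3 U' y -> clique_label h 3 U' y = clique_label h 3 U' z ->
    K * #|S :\: Nb h x y z| <= 12 * n.
  rewrite !in_setI => /andP[_ xr] /andP[_ yr] /andP[_ zr] /and3P[xy yz zx] l1 l2.
  have [V1 [V2 [V3 [[s1 s2 s3] [c1 c2 c3] H]]]] := same_clique_label fg free xr yr zr l1 l2.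
  have near (V : {set T}) : V \subset U' -> #|V| = 3 -> K * #|~: S :\: NS h V| <= 3 * n.
    move=> /subsetP s c; have /card_gt2P[a [b [e [[aV bV eV] [ab be ea]]]]] : 2 < #|V| by rewrite c.
    apply: leq_trans (NbU' a b e (s _ aV) (s _ bV) (s _ eV) _); last by rewrite /distinct3 ab be ea.
    by rewrite leq_mul2l; apply/orP; right; apply: subset_leq_card; apply: setDS; exact: Nb_sub_NS.
  have sub : Nb h x y z :&: ~: S \subset (~: S :\: NS h V1) :|: (~: S :\: NS h V2) :|: (~: S :\: NS h V3).
    apply/subsetP => v; rewrite in_setI => /andP[vN vS]; rewrite !in_setU !in_setD vS !andbT.
    by rewrite -!negb_and; apply/negP => /andP[/andP[v1 v2] v3]; exact: H v vN v1 v2 v3.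
  have := leq_trans (subset_leq_card sub) (card_setU3_le _ _ _).
  have := near _ s1 c1; have := near _ s2 c2; have := near _ s3 c3.
  have h2 := cod _ _ _ xy yz zx; rewrite -/n in h2.
  have := cardsID S (Nb h x y z); have := cardsID (Nb h x y z) S.
  rewrite setIC [Nb h x y z :\: S]setDE.
  move: #|Nb h x y z| h2 #|Nb h x y z :&: S| #|_ :&: ~: S| #|S :\: _| #|S| S2'
    #|_ :\: NS h V1| #|_ :\: NS h V2| #|_ :\: NS h V3|.
  move=> p p2 ps pc sp s sK b c e' h3 h4 h5 h6 h7 h8.
  exact: deficit_le h8 h7 h6 h5 p2 h3 h4 sK.
have cS : #|S| + #|~: S| = n by exact: cardsC.
have cSA : #|~: S| = #|A| + #|~: S :\: A|.
  by rewrite -[#|~: S|](cardsID A) setIA setIid.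
have n1 : 0 < n by lia.
have c1 : 50 * #|~: S :\: A| <= 3 * n by rewrite KE in cA; nia.
have c2 : 100 * #|S| <= 53 * n by rewrite KE in S2'; nia.
have cAm : 2 * n <= 5 * #|A| by lia.
have dAB : [disjoint A & B].
  rewrite -setI_eq0; apply/eqP/setP => v; rewrite !inE; case: [exists x in U, _]; by rewrite ?andbF.
have K0 : 0 < K by rewrite KE; lia.
have small x : K * x <= 12 * n -> 100 * x <= 12 * n.
  by apply: leq_trans; rewrite leq_mul2r KE; apply/orP; right; lia.
have sB : K * \sum_(x in B) \sum_(y in B) \sum_(z in B) \sum_(w in B) h x y z w < #|B| ^ 4.
  apply: (HR1 _ _ fg free B (~: S) _ (clique_label h t U) (clique_labels U) _ L1B _ _ K0).
  - by move=> x _; exact: clique_label_mem.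
  - move=> x y z xB yB zB dis l1 l2; have := NbBc _ _ _ xB yB zB dis l1 l2; have := small #|~: S :\: Nb h x y z|.
    by move: #|~: S :\: Nb h x y z| => a; lia.
  - by rewrite /m0 in nn0; lia.
have sA : K * \sum_(x in A) \sum_(y in A) \sum_(z in A) \sum_(w in A) h x y z w < #|A| ^ 4.
  apply: (HR2 _ _ fg free A S _ (clique_label h 3 U') (clique_labels U') _ _ _ _ K0).
  - by move=> x _; exact: clique_label_mem.
  - by rewrite card_clique_labels cU'.
  - move=> x y z xA yA zA dis l1 l2; have := NbA _ _ _ xA yA zA dis l1 l2; have := small #|S :\: Nb h x y z|.
    by move: #|S :\: Nb h x y z| => a; lia.
  - by rewrite /m0 in nn0; lia.
have pow (X : {set T}) s : s < #|X| ^ 4 -> s <= n ^ 4.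
  by move=> /ltnW /leq_trans; apply; rewrite leq_exp2r // max_card.
have lastK (m : nat) : K * m <= 11 * n ^ 4 -> k * m <= n ^ 4.
  by move: (n ^ 4) => n4; rewrite KE; lia.
have kA : K * n <= 2 * K * #|A| + 18 * n.
  have : K * #|S| + K * #|~: S| = K * n by rewrite -mulnDr cS.
  have : K * #|~: S| = K * #|A| + K * #|~: S :\: A| by rewrite -mulnDr -cSA.
  by lia.
have kB : K * n <= 2 * K * #|B| + 18 * n.
  have : K * #|S| = K * #|B| + K * #|S :\: B| by rewrite -mulnDr -cSB.
  have : K * n <= 2 * (K * #|S|) by rewrite mulnCA leq_mul2l S2 orbT.
  by lia.
have Kn : 3 * K <= n by lia.
exists A, B; split=> //; apply: lastK; apply: missing_le => //; rewrite -/n.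
- exact: pow sA.
- by rewrite disjoint_sym.
- exact: pow sB.
Qed.

(** * From the almost parity partition to an exact one *)

(** Averaging over the [g] triples satisfying [G]: over all triples the costs [F x + F y + F z] sum
    to the right-hand side. *)
Lemma exists_cheap_triple (T : finType) (S : {set T}) (G : T -> T -> T -> bool) (F : T -> nat) :
  let g := \sum_(x in S) \sum_(y in S) \sum_(z in S) G x y z in
  0 < g -> exists x y z, [/\ [/\ x \in S, y \in S & z \in S], G x y z &
    g * (F x + F y + F z) <= 3 * #|S| ^ 2 * \sum_(x in S) F x].
Proof.
move=> g g0; set M := 3 * _ * _.
have [/existsP[x /existsP[y /existsP[z /and5P[xS yS zS H1 H2]]]]|none] := boolP
  [exists x, [exists y, [exists z, [&& x \in S, y \in S, z \in S, G x y z & g * (F x + F y + F z) <= M]]]].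
  by exists x, y, z.
have big x y z : x \in S -> y \in S -> z \in S -> G x y z * M.+1 <= g * (G x y z * (F x + F y + F z)).
  move=> xS yS zS; case E : (G x y z) => //; rewrite !mul1n ltnNge; apply/negP => H.
  move/negP: none; apply; apply/existsP; exists x; apply/existsP; exists y; apply/existsP; exists z.
  by rewrite xS yS zS E.
have tot : \sum_(x in S) \sum_(y in S) \sum_(z in S) (F x + F y + F z) = M.
  rewrite (eq_bigr (fun x => #|S| ^ 2 * F x + 2 * #|S| * \sum_(y in S) F y)).
    rewrite big_split /= sum_nat_const -big_distrr /M /=; lia.
  move=> x _; rewrite (eq_bigr (fun y => #|S| * F x + #|S| * F y + \sum_(y in S) F y)).
    by rewrite !big_split /= !sum_nat_const -big_distrr /=; lia.
  by move=> y _; rewrite !big_split /= !sum_nat_const.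
have : g * M.+1 <= g * M.
  rewrite -[in X in _ <= X]tot {1}/g big_distrl big_distrr; apply: leq_sum => x xS /=.
  rewrite big_distrl big_distrr; apply: leq_sum => y yS /=.
  rewrite big_distrl big_distrr; apply: leq_sum => z zS /=.
  apply: leq_trans (big _ _ _ xS yS zS) _; rewrite leq_mul2l; apply/orP; right.
  by case: (G x y z); rewrite ?mul1n.
by rewrite leq_mul2l ltnn orbF; lia.
Qed.

Definition miss_count (T : finType) (h : T -> T -> T -> T -> bool) (S : {set T}) v :=
  \sum_(x in S) \sum_(y in S) \sum_(z in S) ~~ h x y z v.

(** Divided by [tA * tB], the claim is [lA / tA + lB / tB < 1]: the first ratio is below
    [18 / (37 * Z)], the second below [1 - 1 / (2 * Z)], and 37 exceeds twice 18. *)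
Lemma weight_bound c Z lA lB tA tB : 0 < c -> tB <= c -> c <= 18 * tA -> 37 * Z * lA < c ->
  2 * Z * lB + c < 2 * Z * tB -> tB * lA + tA * lB < tA * tB.
Proof.
move=> c0 h1 h2 h3 h4; have Z0 : 0 < Z by nia.
have [e Ee] : exists e, tB = lB + e by exists (tB - lB); nia.
have he : c < 2 * Z * e by nia.
have prodE : tA * tB = tA * lB + tA * e by rewrite Ee mulnDr.
suff : tB * lA < tA * e by rewrite prodE addnC ltn_add2l.
have tA0 : 0 < tA by lia.
have e0 : 0 < e by nia.
have g1 : tB * (37 * Z * lA) <= c * c by rewrite leq_mul // ltnW.
have g2 : c * c <= 18 * tA * (2 * Z * e) by rewrite leq_mul // ltnW.
have g3 : (37 * Z) * (tB * lA) <= (36 * Z) * (tA * e) by lia.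
have g4 : 0 < tA * e by rewrite muln_gt0 tA0.
by move: (tB * lA) (tA * e) g3 g4 => a b; nia.
Qed.

Section Cleaning.
Variables (T : finType) (h : T -> T -> T -> T -> bool).
Hypotheses (fg : fourgraph h) (free : PG23_free h) (cod : codegree_half h).
Let n := #|T|.

Lemma link_miss_count (S : {set T}) v : link_count h S v + miss_count h S v = #|S| ^ 3.
Proof.
have -> : #|S| ^ 3 = \sum_(x in S) \sum_(y in S) \sum_(z in S) 1.
  by rewrite !sum_nat_const muln1 !expnS expn0 muln1.
rewrite -big_split; apply: eq_bigr => x _ /=; rewrite -big_split; apply: eq_bigr => y _ /=.
by rewrite -big_split; apply: eq_bigr => z _ /=; case: (h x y z v).
Qed.

(* Three triples of the link of [i] on [S] are picked one after the other so that all their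
   transversals are in the links of [p0], [p1], [p2]; with [p0], [p1], [p2] they form PG_2(3) - [i]. *)
Lemma dense_common_link i p0 p1 p2 (S : {set T}) : h i p0 p1 p2 ->
  27 * #|S| ^ 6 * (miss_count h S p0 + miss_count h S p1 + miss_count h S p2) <
     link_count h S i ^ 3 -> False.
Proof.
move=> hi; set g := link_count h S i; set M := _ + _ => lt.
have g0 : 0 < g by move: lt; rewrite lt0n; case: eqP => // ->; rewrite ltn0.
(* [c] counts those of [p0], [p1], [p2] whose links miss the triple; [F1], [F2], [F3] sum it over
   the coordinates still free and the values already chosen. *)
pose c x y z := ~~ h x y z p0 + ~~ h x y z p1 + ~~ h x y z p2.
pose F1 x := \sum_(y in S) \sum_(z in S) c x y z.
have sF1 : \sum_(x in S) F1 x = M.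
  rewrite /M /miss_count -!big_split; apply: eq_bigr => x _ /=.
  by rewrite -!big_split; apply: eq_bigr => y _ /=; rewrite -!big_split.
have [x0 [x1 [x2 [_ Gx cx]]]] := exists_cheap_triple (G := fun x y z => h x y z i) F1 g0.
pose F2 y := \sum_(z in S) (c x0 y z + c x1 y z + c x2 y z).
have sF2 : \sum_(y in S) F2 y = F1 x0 + F1 x1 + F1 x2.
  by rewrite -!big_split; apply: eq_bigr => y _ /=; rewrite -!big_split.
have [y0 [y1 [y2 [_ Gy cy]]]] := exists_cheap_triple (G := fun x y z => h x y z i) F2 g0.
pose F3' y z := c x0 y z + c x1 y z + c x2 y z.
pose F3 z := F3' y0 z + F3' y1 z + F3' y2 z.
have sF3 : \sum_(z in S) F3 z = F2 y0 + F2 y1 + F2 y2 by rewrite -!big_split.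
have [z0 [z1 [z2 [_ Gz cz]]]] := exists_cheap_triple (G := fun x y z => h x y z i) F3 g0.
rewrite -/(link_count h S i) -/g sF1 in cx; rewrite -/(link_count h S i) -/g sF2 in cy.
rewrite -/(link_count h S i) -/g sF3 in cz.
(* Each choice divides the cost by [g] and multiplies it by [3 * #|S| ^ 2]; after three choices the
   hypothesis puts it below 1. *)
have zero : F3 z0 + F3 z1 + F3 z2 = 0.
  move: (F3 z0 + F3 z1 + F3 z2) (F2 y0 + F2 y1 + F2 y2) (F1 x0 + F1 x1 + F1 x2) cx cy cz lt.
  move=> f3 f2 f1; rewrite [#|S| ^ 6](_ : _ = #|S| ^ 2 * #|S| ^ 2 * #|S| ^ 2); last by rewrite -!expnD.
  move: (#|S| ^ 2) => s a1 a2 a3 lt; apply/eqP; rewrite -leqn0 -ltnS.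
  have b2 : g * (g * f2) <= 3 * s * (3 * s * M).
    by apply: (@leq_trans (g * (3 * s * f1))); rewrite ?leq_mul2l ?a2 ?orbT // mulnCA leq_mul2l a1 orbT.
  have b3 : g * (g * (g * f3)) <= 3 * s * (3 * s * (3 * s * M)).
    apply: (@leq_trans (g * (g * (3 * s * f2)))); first by rewrite !leq_mul2l a3 !orbT.
    by rewrite [g * (3 * s * f2)]mulnCA mulnCA leq_mul2l b2 orbT.
  have g3 : 0 < g ^ 3 by rewrite expn_gt0 g0.
  rewrite -(ltn_pmul2l g3) muln1; apply: leq_ltn_trans lt.
  by rewrite !expnS expn0; lia.
have c0 x y z : c x y z = 0 -> [/\ h p0 x y z, h p1 x y z & h p2 x y z].
  rewrite /c ![h _ x y z](hrot fg).
  by case: (h x y z p0); case: (h x y z p1); case: (h x y z p2).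
move: zero; rewrite /F3 /F3' => zero.
have E x y z : x \in [:: x0; x1; x2] -> y \in [:: y0; y1; y2] -> z \in [:: z0; z1; z2] ->
    [/\ h p0 x y z, h p1 x y z & h p2 x y z].
  rewrite !inE => /or3P[] /eqP-> /or3P[] /eqP-> /or3P[] /eqP->; apply: c0; move: zero; clear; lia.
apply: (free (i := i) (p0 := p0) (p1 := p1) (p2 := p2) (a00 := x0) (a01 := x1)
  (a02 := x2) (a10 := y0) (a11 := y1) (a12 := y2) (a20 := z0) (a21 := z1) (a22 := z2)) => //.
- by rewrite hrot.
- by rewrite hrot.
- by rewrite hrot.
all: by match goal with |- is_true (h _ ?x ?y ?z) => case: (E x y z) end; rewrite // !inE eqxx ?orbT.
Qed.

Lemma missingE (A B : {set T}) : missing h A B = \sum_(w in B) miss_count h A w.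
Proof.
rewrite /missing /miss_count [RHS]exchange_big; apply: eq_bigr => x _ /=.
rewrite [RHS]exchange_big; apply: eq_bigr => y _ /=; by rewrite [RHS]exchange_big.
Qed.

(** The dense link on [B] has a triple [b0], [b1], [b2] whose own links on [A] miss little. With [v]
    it is an edge to which [dense_common_link] applies on [A]. *)
Lemma not_both_dense k c (A B : {set T}) v : 0 < n -> k * missing h A B <= n ^ 4 ->
  n ^ 3 <= c * link_count h A v -> n ^ 3 <= c * link_count h B v -> 81 * c ^ 4 < k -> False.
Proof.
move=> n0 km dA dB kc.
have n30 : 0 < n ^ 3 by rewrite expn_gt0 n0.
have gB0 : 0 < link_count h B v by move: dB n30; case: (link_count h B v) => //; lia.
have [b0 [b1 [b2 [_ hb]]]] := exists_cheap_triple (G := fun x y z => h x y z v) (miss_count h A) gB0.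
rewrite -/(link_count h B v) -missingE; set M := _ + _ + _ => cM.
apply: (dense_common_link (i := v) (p0 := b0) (p1 := b1) (p2 := b2) (S := A)).
  by rewrite hrot.
rewrite -/M.
have leA : #|A| ^ 6 <= n ^ 6 by rewrite leq_exp2r // max_card.
have leB : #|B| ^ 2 <= n ^ 2 by rewrite leq_exp2r // max_card.
have c0 : 0 < c by move: dA n30; case: (c) => //; rewrite mul0n; lia.
have gM : k * (link_count h B v * M) <= 3 * n ^ 6.
  apply: leq_trans (_ : k * (3 * #|B| ^ 2 * missing h A B) <= _); first by rewrite leq_mul2l cM orbT.
  rewrite mulnCA -mulnA leq_mul2l /= (_ : n ^ 6 = n ^ 2 * n ^ 4); last by rewrite -expnD.
  by rewrite leq_mul.
have kM : k * M <= 3 * c * n ^ 3.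
  rewrite -(leq_pmul2l n30).
  apply: leq_trans (_ : c * link_count h B v * (k * M) <= _); first by rewrite leq_mul2r dB orbT.
  apply: leq_trans (_ : c * (3 * n ^ 6) <= _); first by rewrite -mulnA leq_mul2l; apply/orP; right; lia.
  by rewrite [n ^ 6](expnD n 3 3); lia.
have dA3 : n ^ 9 <= c ^ 3 * link_count h A v ^ 3.
  by rewrite -expnMn [n ^ 9](expnM n 3 3) leq_exp2r.
have kc3 : 0 < k * c ^ 3 by rewrite muln_gt0 expn_gt0 c0; lia.
rewrite -(ltn_pmul2l kc3).
apply: leq_ltn_trans (_ : 81 * c ^ 4 * n ^ 9 < _).
  apply: leq_trans (_ : c ^ 3 * (27 * n ^ 6) * (k * M) <= _).
    rewrite (_ : k * c ^ 3 * _ = c ^ 3 * (27 * #|A| ^ 6) * (k * M)); last by lia.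
    by rewrite leq_mul2r leq_mul2l leq_mul2l leA !orbT.
  apply: leq_trans (_ : c ^ 3 * (27 * n ^ 6) * (3 * c * n ^ 3) <= _); first by rewrite leq_mul2l kM orbT.
  by rewrite [c ^ 4]expnSr [n ^ 9](expnD n 6 3); lia.
apply: leq_trans (_ : k * n ^ 9 <= _); first by rewrite ltn_pmul2r // expn_gt0 n0.
by rewrite -mulnA leq_mul2l dA3 orbT.
Qed.

Lemma edge_of_good_vertices Z (S : {set T}) i p0 p1 p2 : 0 < n -> 81 * 16 ^ 3 < Z -> 2 * n <= 5 * #|S| ->
  Z * miss_count h S i <= n ^ 3 -> Z * miss_count h S p0 <= n ^ 3 ->
  Z * miss_count h S p1 <= n ^ 3 -> Z * miss_count h S p2 <= n ^ 3 -> ~~ h i p0 p1 p2.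
Proof.
move=> n0 Zbig cS gi g0 g1 g2; apply/negP => H.
apply: (dense_common_link (i := i) (p0 := p0) (p1 := p1) (p2 := p2) (S := S) H).
have n30 : 0 < n ^ 3 by rewrite expn_gt0 n0.
have Z1000 : 1000 <= Z by apply: leq_trans Zbig; rewrite !expnS expn0; lia.
have leS : #|S| ^ 6 <= n ^ 6 by rewrite leq_exp2r // max_card.
have cS3 : 8 * n ^ 3 <= 125 * #|S| ^ 3.
  have : (2 * n) ^ 3 <= (5 * #|S|) ^ 3 by rewrite leq_exp2r.
  by rewrite !expnMn !expnS !expn0; lia.
have lc := link_miss_count S i.
(* [#|S| ^ 3] is at least [8 * n ^ 3 / 125], and 8 / 125 - 1 / 1000 exceeds 1 / 16. *)
have g16 : n ^ 3 <= 16 * link_count h S i.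
  move: (n ^ 3) (#|S| ^ 3) (link_count h S i) (miss_count h S i) cS3 lc gi => c s l m h1 h2 h3.
  have : 1000 * m <= c by apply: leq_trans h3; rewrite leq_mul2r Z1000 orbT.
  lia.
have g9 : n ^ 9 <= 16 ^ 3 * link_count h S i ^ 3.
  by rewrite -expnMn [n ^ 9](expnM n 3 3) leq_exp2r.
have l0 : 0 < link_count h S i ^ 3 by rewrite expn_gt0; lia.
set M := _ + _ + _.
have ZM : Z * M <= 3 * n ^ 3 by rewrite /M !mulnDr; lia.
have Z0 : 0 < Z by lia.
rewrite -(ltn_pmul2l Z0).
apply: leq_ltn_trans (_ : 81 * 16 ^ 3 * link_count h S i ^ 3 < _); last by rewrite ltn_pmul2r.
apply: leq_trans (_ : 27 * n ^ 6 * (Z * M) <= _).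
  by rewrite mulnCA leq_mul2r leq_mul2l leS !orbT.
apply: leq_trans (_ : 27 * n ^ 6 * (3 * n ^ 3) <= _); first by rewrite leq_mul2l ZM orbT.
rewrite -[81 * _ * _]mulnA; apply: leq_trans (_ : 81 * n ^ 9 <= _); last by rewrite leq_mul2l g9 orbT.
by rewrite [n ^ 9](expnD n 6 3); lia.
Qed.

Lemma few_bad_vertices k Z (A B : {set T}) : 0 < n -> k * missing h B A <= n ^ 4 ->
  k * #|A :\: [set v | Z * miss_count h B v <= n ^ 3]| <= Z * n.
Proof.
move=> n0; rewrite missingE; set D := A :\: _ => km.
have n30 : 0 < n ^ 3 by rewrite expn_gt0 n0.
rewrite -(leq_pmul2r n30) -!mulnA -expnS.
apply: leq_trans (_ : Z * (k * \sum_(v in A) miss_count h B v) <= _); last by rewrite leq_mul2l km orbT.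
rewrite [leqRHS]mulnCA leq_mul2l -sum_nat_const; apply/orP; right.
rewrite big_distrr /= big_mkcond [X in _ <= X]big_mkcond; apply: leq_sum => v _.
by case: ifP => [|//]; rewrite !inE -ltnNge => /andP[/ltnW ? ->].
Qed.

(** A triple of [A] not counted by [f] has a deleted vertex in one of three positions or a
    repetition at one of three pairs of positions. *)
Lemma falling_lower (A D : {set T}) : let A1 := A :\: D in let f := #|A1| * (#|A1| - 1) * (#|A1| - 2) in
  #|A| ^ 3 <= f + 3 * n ^ 2 * (#|A :&: D| + 1).
Proof.
move=> /=; set A1 := A :\: D; have cA : #|A :&: D| + #|A1| = #|A| by exact: cardsID.
have An : #|A| <= n by exact: max_card.
move: cA; move: #|A1| #|A :&: D| => a d cA; move: An; rewrite -cA => An.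
have h1 : a ^ 3 <= a * (a - 1) * (a - 2) + 3 * a ^ 2.
  clear cA An; case: a => [|[|a]] //; rewrite !subSS subn0 subn0 !expnS expn0; nia.
have h2 : (d + a) ^ 3 <= a ^ 3 + 3 * (d + a) ^ 2 * d by rewrite !expnS !expn0; nia.
have h3 : (d + a) ^ 2 <= n ^ 2 by rewrite leq_exp2r.
have h4 : a ^ 2 <= n ^ 2 by rewrite leq_exp2r //; lia.
have h5 : (d + a) ^ 2 * d <= n ^ 2 * d by rewrite leq_mul2r h3 orbT.
by rewrite mulnDr muln1; lia.
Qed.

Lemma leq_sum_subset (A B : {set T}) (F G : T -> nat) : A \subset B -> (forall x, F x <= G x) ->
  \sum_(x in A) F x <= \sum_(x in B) G x.
Proof.
move=> AB FG; rewrite big_mkcond [leqRHS]big_mkcond; apply: leq_sum => x _.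
by case: ifP => // /(subsetP AB)->.
Qed.

(** A triple of [A1] has no neighbour in [As], so its at least [n / 2] neighbours lie in [Bs] or
    [W]; sum this over the [f] triples. *)
Lemma half_tally (A A1 As Bs W : {set T}) :
  (forall x y z w, x \in As -> y \in As -> z \in As -> w \in As -> ~~ h x y z w) ->
  ~: As \subset Bs :|: W -> A1 \subset A -> A1 \subset As ->
  let f := #|A1| * (#|A1| - 1) * (#|A1| - 2) in
  f * n <= 2 * (f * #|Bs|) + 2 * \sum_(w in W) link_count h A w.
Proof.
move=> indep cover sA sAs /=; set f := #|A1| * (#|A1| - 1) * (#|A1| - 2).
have le : \sum_(x in A1) \sum_(y in A1) \sum_(z in A1) \sum_(w in W) h x y z w <=
    \sum_(w in W) link_count h A w.
  rewrite /link_count [leqRHS]exchange_big; apply: leq_sum_subset => // x /=.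
  rewrite [leqRHS]exchange_big; apply: leq_sum_subset => // y /=.
  by rewrite [leqRHS]exchange_big; apply: leq_sum_subset.
apply: leq_trans (_ : 2 * (f * #|Bs|) +
   2 * \sum_(x in A1) \sum_(y in A1) \sum_(z in A1) \sum_(w in W) h x y z w <= _); last first.
  by rewrite leq_add2l leq_mul2l le.
rewrite -mulnDr /f -sum_distinct3 !big_distrl -big_split big_distrr; apply: leq_sum => x xA /=.
rewrite !big_distrl -big_split big_distrr; apply: leq_sum => y yA /=.
rewrite !big_distrl -big_split big_distrr; apply: leq_sum => z zA /=.
have [/and3P[xy yz zx]|_] := boolP (distinct3 x y z); last by rewrite mul0n.
rewrite !mul1n sum_mem_card; apply: leq_trans (cod xy yz zx) _; rewrite leq_mul2l /=.
apply: leq_trans (leq_card_setU _ _); apply: subset_leq_card; apply/subsetP => w.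
rewrite !inE => H; have wAs : w \in ~: As.
  rewrite inE; apply/negP => wAs; move/negP: (indep x y z w (subsetP sAs _ xA)
    (subsetP sAs _ yA) (subsetP sAs _ zA) wAs); by apply.
by move/(subsetP cover): wAs; rewrite inE H andbT.
Qed.

(* Summed over the vertices [w] outside both sides, this says that they see too few triples inside
   the sides to supply the neighbours which those triples lack. *)
Lemma wild_weight k Z (A B Da Db : {set T}) fa fb w :
  0 < n -> 81 * (37 * Z) ^ 4 < k -> k * missing h A B <= n ^ 4 -> 63 < Z -> 12 * Z <= n ->
  2 * n <= 5 * #|A| -> 2 * n <= 5 * #|B| -> 12 * Z ^ 2 <= k ->
  k * #|Da| <= Z * n -> k * #|Db| <= Z * n ->
  #|A| ^ 3 <= fa + 3 * n ^ 2 * (#|Da| + 1) -> #|B| ^ 3 <= fb + 3 * n ^ 2 * (#|Db| + 1) ->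
  fa <= n ^ 3 -> fb <= n ^ 3 -> n ^ 3 < Z * miss_count h A w -> n ^ 3 < Z * miss_count h B w ->
  fb * link_count h A w + fa * link_count h B w < fa * fb.
Proof.
move=> n0 kc km Z63 Zn cA cB kZ kDa kDb hfa hfb fan fbn mA mB.
have n30 : 0 < n ^ 3 by rewrite expn_gt0 n0.
have Z0 : 0 < Z by lia.
have small D : k * #|D : {set T}| <= Z * n -> Z * (3 * n ^ 2 * (#|D| + 1)) * 2 <= n ^ 3.
  move=> kD; have : 12 * Z ^ 2 * #|D| <= Z * n by apply: leq_trans kD; rewrite leq_mul2r kZ orbT.
  have -> : 12 * Z ^ 2 * #|D| = Z * (12 * Z * #|D|) by rewrite !expnS expn0; lia.
  rewrite leq_pmul2l // => ZD.
  have g : 12 * Z * (#|D| + 1) <= 2 * n by rewrite mulnDr; lia.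
  have : 12 * Z * (#|D| + 1) * n ^ 2 <= 2 * n * n ^ 2 by rewrite leq_mul2r g orbT.
  by rewrite [n ^ 3]expnS; lia.
(* The bounds on [Z] and [k] make the deletions cost at most [n ^ 3 / 126], and 8 / 125 - 1 / 126
   exceeds 1 / 18. *)
have big3 (S : {set T}) f (D : {set T}) : 2 * n <= 5 * #|S| -> k * #|D| <= Z * n ->
    #|S| ^ 3 <= f + 3 * n ^ 2 * (#|D| + 1) -> n ^ 3 <= 18 * f.
  move=> cS /small sm hf.
  have cS3 : 8 * n ^ 3 <= 125 * #|S| ^ 3.
    have : (2 * n) ^ 3 <= (5 * #|S|) ^ 3 by rewrite leq_exp2r.
    by rewrite !expnMn !expnS !expn0; lia.
  move: (3 * n ^ 2 * (#|D| + 1)) (n ^ 3) (#|S| ^ 3) sm hf cS3 => d c s sm hf cS3.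
  have : 63 * d <= Z * d by rewrite leq_mul2r (ltnW Z63) orbT.
  lia.
(* More than [n ^ 3 / Z] triples miss [w], and the deletions account for at most half of that. *)
have lost (S : {set T}) f (D : {set T}) : k * #|D| <= Z * n -> n ^ 3 < Z * miss_count h S w ->
    #|S| ^ 3 <= f + 3 * n ^ 2 * (#|D| + 1) -> 2 * Z * link_count h S w + n ^ 3 < 2 * Z * f.
  move=> /small sm mS hf; have lc := link_miss_count S w.
  move: (3 * n ^ 2 * (#|D| + 1)) (n ^ 3) (#|S| ^ 3) (link_count h S w) (miss_count h S w) sm mS hf lc.
  move=> e c s l m sm mS hf lc; have : Z * (l + m) <= Z * (f + e) by rewrite leq_mul2l lc hf orbT.
  by rewrite !mulnDr; move: sm mS; clear; lia.
(* One of the two links is thin; it takes the role of [lA] in [weight_bound]. *)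
have := not_both_dense (v := w) n0 km _ _ kc.
case: (leqP (n ^ 3) (37 * Z * link_count h A w)) => dA.
  case: (leqP (n ^ 3) (37 * Z * link_count h B w)) => dB; first by move/(_ isT isT).
  move=> _; rewrite addnC [ltnRHS]mulnC.
  by apply: (weight_bound n30 fan (big3 _ _ _ cB kDb hfb) dB); exact: lost kDa mA hfa.
by move=> _; apply: (weight_bound n30 fbn (big3 _ _ _ cA kDa hfa) dA); exact: lost kDb mB hfb.
Qed.

End Cleaning.

Lemma exact_parity_partition : exists n0, forall (T : finType) (h : T -> T -> T -> T -> bool),
  fourgraph h -> PG23_free h -> codegree_half h -> n0 <= #|T| ->
  exists A : {set T}, [/\
    forall x y z w, x \in A -> y \in A -> z \in A -> w \in A -> ~~ h x y z w,
    forall x y z w, x \notin A -> y \notin A -> z \notin A -> w \notin A -> ~~ h x y z w,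
    #|T| <= 3 * #|A| & #|T| <= 3 * #|~: A|].
Proof.
have [Z Zbig] : exists Z, 81 * 16 ^ 3 < Z by exists (81 * 16 ^ 3).+1; exact: leqnn.
(* The first bound is the threshold of [not_both_dense] with [c = 37 * Z]; the second leaves at most
   [n / (12 * Z)] bad vertices on each side. *)
have [k [kc kZ]] : exists k, 81 * (37 * Z) ^ 4 < k /\ 12 * Z ^ 2 <= k.
  exists (maxn (81 * (37 * Z) ^ 4).+1 (12 * Z ^ 2)); split; [exact: leq_maxl|exact: leq_maxr].
have k0 : 0 < k by apply: leq_trans kc.
have [n1 Hn1] := almost_parity_partition k0.
exists (n1 + 12 * Z) => T h fg free cod; set n := #|T| => nn0.
have Z63 : 100 < Z by apply: leq_trans Zbig; rewrite !expnS expn0; lia.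
have n0 : 0 < n by lia.
have [|A [B [dAB cA cB mAB mBA]]] := Hn1 T h fg free cod; first by lia.
rewrite -/n in cA cB mAB mBA.
(* Goodness is tested on all vertices: those left over by the first partition may be good, and [As]
   need not lie in [A]. *)
pose As := [set v | Z * miss_count h B v <= n ^ 3].
pose Bs := [set v | Z * miss_count h A v <= n ^ 3].
have iA x y z w : x \in As -> y \in As -> z \in As -> w \in As -> ~~ h x y z w.
  by rewrite !inE => *; apply: (edge_of_good_vertices fg free (Z := Z) (S := B)).
have iB x y z w : x \in Bs -> y \in Bs -> z \in Bs -> w \in Bs -> ~~ h x y z w.
  by rewrite !inE => *; apply: (edge_of_good_vertices fg free (Z := Z) (S := A)).
have dense (S : {set T}) v : 2 * n <= 5 * #|S| -> Z * miss_count h S v <= n ^ 3 -> n ^ 3 <= 37 * Z * link_count h S v.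
  move=> cS gv; have cS3 : 8 * n ^ 3 <= 125 * #|S| ^ 3.
    have : (2 * n) ^ 3 <= (5 * #|S|) ^ 3 by rewrite leq_exp2r.
    by rewrite !expnMn !expnS !expn0; lia.
  have := link_miss_count h S v.
  move: (n ^ 3) (#|S| ^ 3) (link_count h S v) (miss_count h S v) cS3 gv => c s l m h1 h2 h3.
  have : 100 * m <= c by apply: leq_trans h2; rewrite leq_mul2r (ltnW Z63) orbT.
  have : 100 * l <= Z * l by rewrite leq_mul2r (ltnW Z63) orbT.
  lia.
have dABs : [disjoint As & Bs].
  rewrite -setI_eq0; apply/eqP/setP => v; rewrite !inE; apply/negP => /andP[vA vB].
  exact: (not_both_dense fg free n0 mAB (dense _ _ cA vB) (dense _ _ cB vA) kc).
pose W := ~: (As :|: Bs).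
have bA := few_bad_vertices Z n0 mBA; have bB := few_bad_vertices Z n0 mAB.
rewrite -/n -/As in bA; rewrite -/n -/Bs in bB.
have lA := falling_lower A (~: As); have lB := falling_lower B (~: Bs).
rewrite /= -[A :&: ~: As]setDE -/n in lA; rewrite /= -[B :&: ~: Bs]setDE -/n in lB.
have sub1 (X Xs : {set T}) : X :\: ~: Xs \subset X by rewrite subsetDl.
have sub2 (X Xs : {set T}) : X :\: ~: Xs \subset Xs by rewrite setDE setCK subsetIr.
have tA := half_tally cod iA (Bs := Bs) (W := W) _ (sub1 A As) (sub2 A As).
have tB := half_tally cod iB (Bs := As) (W := W) _ (sub1 B Bs) (sub2 B Bs).
move: lA lB tA tB; set a1 := #|A :\: ~: As|; set b1 := #|B :\: ~: Bs|.
set fa := a1 * _ * _; set fb := b1 * _ * _ => lA lB tA tB.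
have {}tA : fa * n <= 2 * (fa * #|Bs|) + 2 * \sum_(w in W) link_count h A w.
  by apply: tA; apply/subsetP => v; rewrite /W !inE; case: (_ <= n ^ 3) => //=; case: (_ <= n ^ 3).
have {}tB : fb * n <= 2 * (fb * #|As|) + 2 * \sum_(w in W) link_count h B w.
  by apply: tB; apply/subsetP => v; rewrite /W !inE orbC; case: (_ * _ <= n ^ 3) => //=; case: (_ <= n ^ 3).
have fal m : m <= n -> m * (m - 1) * (m - 2) <= n ^ 3.
  by move=> mn; rewrite !expnS expn0 muln1 mulnA !leq_mul //; lia.
have fan : fa <= n ^ 3 by apply: fal; exact: max_card.
have fbn : fb <= n ^ 3 by apply: fal; exact: max_card.
have cW : #|As| + #|Bs| + #|W| = n.
  have := cardsC (As :|: Bs); rewrite -/W cardsU (disjoint_setI0 dABs) cards0 subn0; lia.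
have wild w : w \in W -> fb * link_count h A w + fa * link_count h B w < fa * fb.
  rewrite /W !inE negb_or -!ltnNge => /andP[wB wA].
  by apply: (wild_weight fg free (k := k) (Z := Z) (Da := A :\: As) (Db := B :\: Bs)) => //; lia.
(* The two tallies, weighted by [fb] and [fa], give the vertices of [W] an average weight of at
   least [fa * fb], against [wild]. *)
have W0 : #|W| = 0.
  apply/eqP; rewrite -leqn0 leqNgt; apply/negP => Wpos.
  have : #|W| * (fa * fb) <= fb * \sum_(w in W) link_count h A w + fa * \sum_(w in W) link_count h B w.
    have g1 : fb * (fa * n) <= fb * (2 * (fa * #|Bs|) + 2 * \sum_(w in W) link_count h A w).
      by rewrite leq_mul2l tA orbT.
    have g2 : fa * (fb * n) <= fa * (2 * (fb * #|As|) + 2 * \sum_(w in W) link_count h B w).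
      by rewrite leq_mul2l tB orbT.
    move: g1 g2; rewrite -cW; move: (\sum_(w in W) _) (\sum_(w in W) _); clear; move=> x y; lia.
  rewrite !big_distrr -big_split /= => le.
  have : \sum_(w in W) (fb * link_count h A w + fa * link_count h B w).+1 <= #|W| * (fa * fb).
    by rewrite -sum_nat_const; apply: leq_sum => w /wild.
  under eq_bigr do rewrite -addn1; rewrite big_split /= sum1_card; lia.
have AsC : ~: As = Bs.
  apply/setP => v; have /eqP := cards0_eq W0; rewrite -subset0 => /subsetP/(_ v).
  have /setP/(_ v) := disjoint_setI0 dABs; rewrite /W !in_setC !in_setI !in_setU !in_set0.
  by case: (v \in As); case: (v \in Bs) => //= _ /(_ isT).
have third (X Xs : {set T}) : 2 * n <= 5 * #|X| -> k * #|X :\: Xs| <= Z * n -> n <= 3 * #|Xs|.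
  move=> cX kX; have : 12 * Z ^ 2 * #|X :\: Xs| <= Z * n by apply: leq_trans kX; rewrite leq_mul2r kZ orbT.
  have -> : 12 * Z ^ 2 * #|X :\: Xs| = Z * (12 * Z * #|X :\: Xs|) by rewrite !expnS expn0; lia.
  have Z0 : 0 < Z by lia.
  rewrite leq_pmul2l // => ZD.
  have : 1200 * #|X :\: Xs| <= 12 * Z * #|X :\: Xs| by rewrite leq_mul2r; apply/orP; right; lia.
  have : #|X :&: Xs| <= #|Xs| by rewrite subset_leq_card // subsetIr.
  have := cardsID Xs X; lia.
exists As; split=> //.
- by move=> x y z w; rewrite -!in_setC AsC; exact: iB.
- exact: third cA bA.
- by rewrite AsC; exact: third cB bB.
Qed.

(** * Exact parity is impossible *)

Lemma exists_avoiding (T : finType) (S : {set T}) (s : seq T) : size s < #|S| ->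
  exists2 x, x \in S & x \notin s.
Proof.
move=> lt; have [sub|/subsetPn[x xS xs]] := boolP (S \subset [set x in s]).
  move: (leq_trans lt (subset_leq_card sub)); rewrite cardsE ltnNge => /negP[]; exact: card_size.
by exists x => //; move: xs; rewrite inE.
Qed.

(** * Rainbow matchings in three graphs of minimum degree two *)

Section RainbowMatching.
Variables (T : finType) (Y : {set T}).
Hypothesis Y25 : 24 < #|Y|.

Definition gnbr (g : rel T) b := [set b' in Y | g b b'].

(** The bound 5 leaves room to avoid the at most four vertices excluded when disjoint edges are
    chosen at three centres; four neighbourhoods of non-centres and four more vertices make at most
    24 in [two_centers]. *)
Definition centers (g : rel T) := [set x in Y | 5 < #|gnbr g x|].

Definition min_degree2 (g : rel T) := [/\ symmetric g, irreflexive g & {in Y, forall y, 1 < #|gnbr g y|}].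

Definition no_rainbow (g1 g2 g3 : rel T) := forall b1 b2 b3 b4 b5 b6,
  all (mem Y) [:: b1; b2; b3; b4; b5; b6] -> uniq [:: b1; b2; b3; b4; b5; b6] ->
  g1 b1 b2 -> g2 b3 b4 -> g3 b5 b6 -> False.

Lemma no_rainbow12 g1 g2 g3 : no_rainbow g1 g2 g3 -> no_rainbow g2 g1 g3.
Proof.
move=> H b1 b2 b3 b4 b5 b6 /= /and5P[y1 y2 y3 y4 /and3P[y5 y6 _]] U e1 e2 e3.
have/perm_uniq E : perm_eq [:: b3; b4; b1; b2; b5; b6] [:: b1; b2; b3; b4; b5; b6].
  by rewrite (perm_catCA [:: b3; b4] [:: b1; b2] [:: b5; b6]).
by apply: (H b3 b4 b1 b2 b5 b6); rewrite ?E //= y1 y2 y3 y4 y5 y6.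
Qed.

Lemma no_rainbow23 g1 g2 g3 : no_rainbow g1 g2 g3 -> no_rainbow g1 g3 g2.
Proof.
move=> H b1 b2 b3 b4 b5 b6 /= /and5P[y1 y2 y3 y4 /and3P[y5 y6 _]] U e1 e2 e3.
have/perm_uniq E : perm_eq [:: b1; b2; b5; b6; b3; b4] [:: b1; b2; b3; b4; b5; b6].
  by rewrite (perm_cat2l [:: b1; b2] [:: b5; b6; b3; b4] [:: b3; b4; b5; b6]) (perm_catC [:: b5; b6]).
by apply: (H b1 b2 b5 b6 b3 b4); rewrite ?E //= y1 y2 y3 y4 y5 y6.
Qed.

Lemma edge_avoiding (g : rel T) y s : min_degree2 g -> y \in Y -> size s < 2 ->
  exists2 z, z \in Y & g y z && (z \notin s).
Proof.
move=> [_ _ dg] yY ss; have [z] := exists_avoiding (leq_trans ss (dg y yY)).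
by rewrite inE => /andP[zY gz] zs; exists z; rewrite // gz.
Qed.

(** Take an edge [x y] of [g1]. If every edge of [g2] at a vertex of [Y] meets it, all other
    vertices are [g2]-adjacent to both [x] and [y]. Then another [g1]-edge [z w] leaves one of [x],
    [y] free for a [g2]-edge from a fresh [t]. *)
Lemma disjoint_edges g1 g2 : min_degree2 g1 -> min_degree2 g2 ->
  exists b1 b2 b3 b4, [/\ all (mem Y) [:: b1; b2; b3; b4], uniq [:: b1; b2; b3; b4], g1 b1 b2 & g2 b3 b4].
Proof.
move=> d1 d2; have [[s1 i1 _] [s2 i2 _]] := (d1, d2).
have [x xY _] : exists2 x, x \in Y & x \notin [::] by apply: exists_avoiding; exact: leq_ltn_trans Y25.
have [y yY /andP[gxy _]] := @edge_avoiding g1 x [::] d1 xY isT.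
have nxy : x != y by apply/eqP => E; move: gxy; rewrite E i1.
case: (boolP [exists z in Y, [exists w in Y, [&& g2 z w, z \notin [:: x; y] & w \notin [:: x; y]]]]).
  case/exists_inP=> z zY /exists_inP[w wY /and3P[gzw zn wn]].
  exists x, y, z, w; split=> //=; rewrite ?xY ?yY ?zY ?wY //.
  have nzw : z != w by apply/eqP => E; move: gzw; rewrite E i2.
  move: zn wn; rewrite !inE !negb_or nxy nzw [z == x]eq_sym [z == y]eq_sym [w == x]eq_sym [w == y]eq_sym.
  by do ?case: (_ == _).
move=> none; have star z : z \in Y -> z \notin [:: x; y] -> g2 z x /\ g2 z y.
  move=> zY zn; have to s : size s < 2 -> exists w, [&& g2 z w, w \notin s & w \in [:: x; y]].
    move=> /(edge_avoiding d2 zY)[w wY /andP[gzw ws]]; exists w; rewrite gzw ws /=.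
    apply/negPn/negP => wn; move/exists_inP: none; apply; exists z => //; apply/exists_inP; exists w => //.
    by rewrite gzw zn wn.
  have [w1 /and3P[g1' n1 m1]] := to [:: y] isT; have [w2 /and3P[g2' n2 m2]] := to [:: x] isT.
  move: m1 n1 m2 n2; rewrite !inE => /orP[]/eqP E1; last by rewrite E1 eqxx.
  by move=> _ /orP[]/eqP E2; first rewrite E2 eqxx //; move=> _; rewrite -E1 -E2.
have [z zY zn] : exists2 z, z \in Y & z \notin [:: x; y] by apply: exists_avoiding; apply: leq_ltn_trans Y25.
have [w wY /andP[gzw _]] := @edge_avoiding g1 z [::] d1 zY isT.
have nzw : z != w by apply/eqP => E; move: gzw; rewrite E i1.
have [t tY tn] : exists2 t, t \in Y & t \notin [:: x; y; z; w] by apply: exists_avoiding; apply: leq_ltn_trans Y25.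
have [gx gy] : g2 t x /\ g2 t y.
  by apply: star => //; move: tn; rewrite !inE !negb_or => /and4P[-> -> _ _].
move: zn tn; rewrite !inE !negb_or => /andP[zx zy] /and4P[tx ty tz tw].
have [E|wx] := eqVneq w x.
  exists z, x, t, y; rewrite E in gzw; split=> //=; first by rewrite zY xY tY yY.
  by rewrite !inE !negb_or zx zy nxy ty ![_ == t]eq_sym tz tx.
exists z, w, t, x; split=> //=; first by rewrite zY wY tY xY.
by rewrite !inE !negb_or zx nzw wx tx ![_ == t]eq_sym tz tw.
Qed.

(** Fix disjoint edges of [g1] and [g2]. With at most one centre, any further vertex has a
    [g3]-neighbour that is no centre, and this must be one of the four vertices used; these have too
    few neighbours. *)
Lemma two_centers g1 g2 g3 : min_degree2 g1 -> min_degree2 g2 -> min_degree2 g3 ->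
  no_rainbow g1 g2 g3 -> 1 < #|centers g3|.
Proof.
move=> d1 d2 d3 nr; have [s3 i3 dg3] := d3.
have [b1 [b2 [b3 [b4 [inY U e1 e2]]]]] := disjoint_edges d1 d2.
rewrite ltnNge; apply/negP => C1; set s := [:: b1; b2; b3; b4] in inY U.
pose F x := if x \in centers g3 then set0 else gnbr g3 x.
have cF x : x \in Y -> #|F x| <= 5.
  by rewrite /F inE => -> /=; case: ltnP => // _; rewrite cards0.
have : Y \subset [set x in s] :|: (F b1 :|: F b2 :|: F b3 :|: F b4).
  apply/subsetP => y yY; rewrite in_setU inE; have [//|ys /=] := boolP (y \in s).
  have [z zN zC] : exists2 z, z \in gnbr g3 y & z \notin enum (centers g3).
    by apply: exists_avoiding; rewrite -cardE; apply: leq_ltn_trans C1 (dg3 y yY).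
  move: zN zC; rewrite inE mem_enum => /andP[zY gyz] zC.
  have zs : z \in s.
    apply/negPn/negP => zs; apply: (nr b1 b2 b3 b4 y z) => //.
      by move: inY; rewrite /= yY zY => /and5P[-> -> -> -> _].
    have nyz : y != z by apply/eqP => E; move: gyz; rewrite E i3.
    rewrite (cat_uniq s [:: y; z]) U /= !inE nyz andbT orbF negb_or /=.
    by move: ys zs; rewrite /s !inE !andbT => -> ->.
  have : y \in F z by rewrite /F (negPf zC) inE yY s3.
  by move: zs; rewrite !in_setU !inE => /or4P[] /eqP-> ->; rewrite ?orbT.
move/subset_leq_card; apply/negP; rewrite -ltnNge; apply: leq_trans Y25; rewrite ltnS.
apply: leq_trans (leq_card_setU _ _) _.
have : #|[set x in s]| <= 4 by rewrite cardsE; exact: card_size.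
move: inY; rewrite /= => /and5P[/cF y1 /cF y2 /cF y3 /cF y4 _].
have := card_setU4_le (F b1) (F b2) (F b3) (F b4); lia.
Qed.

(** Distinct centres, one for each graph, extend greedily to disjoint edges. So for centres
    [c1 != c2] of [g1] and [g2], every centre of [g3] is one of them, and by [two_centers] both
    occur. *)
Lemma centers_coincide g1 g2 g3 : min_degree2 g1 -> min_degree2 g2 -> min_degree2 g3 ->
  no_rainbow g1 g2 g3 -> centers g1 \subset centers g3 /\ #|centers g3| = 2.
Proof.
move=> d1 d2 d3 nr; have C3 := two_centers d1 d2 d3 nr.
have C2 := two_centers d1 d3 d2 (no_rainbow23 nr).
have C1 := two_centers d3 d2 d1 (no_rainbow12 (no_rainbow23 (no_rainbow12 nr))).
have [[_ i1 _] [_ i2 _] [_ i3 _]] := And3 d1 d2 d3.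
have sdr c1 c2 c3 : c1 \in centers g1 -> c2 \in centers g2 -> c3 \in centers g3 ->
   c1 != c2 -> c1 != c3 -> c2 != c3 -> False.
  rewrite !inE => /andP[y1 n1] /andP[y2 n2] /andP[y3 n3] c12 c13 c23.
  have [e1 e1N e1a] : exists2 d, d \in gnbr g1 c1 & d \notin [:: c2; c3].
    by apply: exists_avoiding; apply: leq_trans n1.
  have [e2 e2N e2a] : exists2 d, d \in gnbr g2 c2 & d \notin [:: c1; c3; e1].
    by apply: exists_avoiding; apply: leq_trans n2.
  have [e3 e3N e3a] : exists2 d, d \in gnbr g3 c3 & d \notin [:: c1; c2; e1; e2].
    by apply: exists_avoiding; apply: leq_trans n3.
  move: e1N e2N e3N; rewrite !inE => /andP[z1 g1e] /andP[z2 g2e] /andP[z3 g3e].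
  have f1 : c1 != e1 by apply/eqP => E; move: g1e; rewrite -E i1.
  have f2 : c2 != e2 by apply/eqP => E; move: g2e; rewrite -E i2.
  have f3 : c3 != e3 by apply/eqP => E; move: g3e; rewrite -E i3.
  apply: (nr c1 e1 c2 e2 c3 e3) => //=; first by rewrite y1 y2 y3 z1 z2 z3.
  move: e1a e2a e3a; rewrite !inE !negb_or => /andP[h1 h2] /and3P[h3 h4 h5] /and4P[h6 h7 h8 h9].
  by rewrite f1 c12 c13 f2 c23 f3 h1 h2 ![_ == e2]eq_sym ![_ == e3]eq_sym h3 h4 h5 h6 h7 h8 h9.
have key c1 : c1 \in centers g1 -> c1 \in centers g3 /\ #|centers g3| <= 2.
  move=> c1C; have [c2 c2C] : exists2 c2, c2 \in centers g2 & c2 \notin [:: c1] by exact: exists_avoiding.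
  rewrite inE eq_sym => c12.
  have sub : centers g3 \subset [set c1; c2].
    apply/subsetP => c3 c3C; rewrite !inE; apply/negPn/negP; rewrite negb_or => /andP[n1 n2].
    by apply: (sdr c1 c2 c3) => //; rewrite eq_sym.
  have le2 : #|centers g3| <= 2 by rewrite -[2](_ : #|[set c1; c2]| = _) ?subset_leq_card // cards2 c12.
  split=> //; have /eqP -> : centers g3 == [set c1; c2] by rewrite eqEcard sub cards2 c12.
  by rewrite !inE eqxx.
split; first by apply/subsetP => c /key[].
have [c cC] : exists c, c \in centers g1 by apply/card_gt0P; exact: ltnW.
by apply/eqP; rewrite eqn_leq C3; case: (key c cC) => _ ->.
Qed.

End RainbowMatching.

Ltac neq3 := apply/and3P; split; first [done | rewrite eq_sym; done].

(** * The graphs of pairs in a complete parity partition *)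

Section CompleteParity.
Variables (T : finType) (h : T -> T -> T -> T -> bool).
Hypotheses (fg : fourgraph h) (free : PG23_free h).

Record half (X Y : {set T}) : Prop := Half {
  half_large : 24 < #|Y|;
  half_edge : forall x y z w, x \in X -> y \in X -> z \in X -> distinct3 x y z -> w \in Y -> h x y z w;
  half_deg : forall u v b, u \in X -> v \in X -> u != v -> b \in Y -> 1 < #|gnbr Y (h u v) b| }.

Lemma half_min_degree2 X Y u v : half X Y -> u \in X -> v \in X -> u != v -> min_degree2 Y (h u v).
Proof.
move=> [_ _ deg] uX vX uv; split=> [b b'|b|b bY]; first exact: (h34 fg).
  by apply/negP => /(h_distinct fg)[_ [_ _]]; rewrite eqxx.
exact: deg.
Qed.

(* Colouring of PG_2(3) used: [u], [v], [w] form a triangle; the remaining two points of its three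
   sides are in [Y] and the four points off the triangle are in [X].  All lines but the sides of
   the triangle meet [X] in one or three points. *)
Lemma pairs_no_rainbow X Y u v w : half X Y -> half Y X -> u \in X -> v \in X -> w \in X ->
  distinct3 u v w -> no_rainbow Y (h u v) (h u w) (h v w).
Proof.
move=> [_ XY _] [X24 YX _] uX vX wX /and3P[uv vw wu] b1 b2 b3 b4 b5 b6.
rewrite /= => /and5P[y1 y2 y3 y4 /and3P[y5 y6 _]] U e1 e2 e3.
have av s : size s < 7 -> exists2 x, x \in X & x \notin s.
  by move=> ss; apply: exists_avoiding; apply: leq_trans X24; apply: leq_trans ss _.
have [x1 X1 n1] := av [:: u; v; w] isT.
have [x2 X2 n2] := av [:: u; v; w; x1] isT.
have [x3 X3 n3] := av [:: u; v; w; x1; x2] isT.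
have [x4 X4 n4] := av [:: u; v; w; x1; x2; x3] isT.
move: n1 n2 n3 n4 U; rewrite !inE !negb_or.
move=> /and3P[m1 m2 m3] /and4P[m4 m5 m6 m7] /and5P[m8 m9 m10 m11 m12].
move=> /and5P[m13 m14 m15 m16 /andP[m17 m18]].
move=> /and5P[/and5P[k1 k2 k3 k4 k5] /and4P[k6 k7 k8 k9] /and3P[k10 k11 k12] /andP[k13 k14] k15].
have XXYX x y z t : x \in X -> y \in X -> z \in X -> distinct3 x y z -> t \in Y -> h x y t z.
  by move=> *; rewrite (h34 fg); apply: XY.
have XYXX x y z t : x \in X -> y \in X -> z \in X -> distinct3 x y z -> t \in Y -> h x t y z.
  by move=> *; rewrite (h23 fg); apply: XXYX.
have YXXX x y z t : x \in X -> y \in X -> z \in X -> distinct3 x y z -> t \in Y -> h t x y z.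
  by move=> *; rewrite (h12 fg); apply: XYXX.
have YYXY x y z t : x \in Y -> y \in Y -> z \in Y -> distinct3 x y z -> t \in X -> h x y t z.
  by move=> *; rewrite (h34 fg); apply: YX.
(* The sides of the triangle are the lines [i p0 p1 p2], [i a00 a01 a02] and [p0 a00 a10 a20], given
   by the rainbow edges; the other ten are of odd type. *)
apply: (free (i := u) (p0 := v) (p1 := b1) (p2 := b2) (a00 := w) (a01 := b3) (a02 := b4)
  (a10 := b5) (a11 := x1) (a12 := x2) (a20 := b6) (a21 := x3) (a22 := x4)) => //.
- by apply: XYXX => //; neq3.
- by apply: XYXX => //; neq3.
- by apply: XYXX => //; neq3.
- by apply: XYXX => //; neq3.
- by apply: YXXX => //; neq3.
- by apply: YYXY => //; neq3.
- by apply: YX => //; neq3.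
- by apply: YXXX => //; neq3.
- by apply: YX => //; neq3.
- by apply: YYXY => //; neq3.
Qed.

Lemma half_centers X Y u v w : half X Y -> half Y X -> u \in X -> v \in X -> w \in X ->
  distinct3 u v w -> centers Y (h u v) \subset centers Y (h u w) /\ #|centers Y (h u w)| = 2.
Proof.
move=> HX HY uX vX wX d; have /and3P[uv vw wu] := d.
apply: (@centers_coincide _ Y (half_large HX) _ (h v w)).
- exact: half_min_degree2 HX uX vX uv.
- exact: half_min_degree2 HX vX wX vw.
- by apply: (half_min_degree2 HX) => //; rewrite eq_sym.
- by apply: no_rainbow23; apply: (pairs_no_rainbow HX HY).
Qed.

(** A centre passes between pairs that share a vertex: from [a b] to every pair at [a], and from
    there to all pairs. *)
Lemma common_center X Y : half X Y -> half Y X ->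
  exists2 x, x \in Y & forall u v, u \in X -> v \in X -> u != v -> x \in centers Y (h u v).
Proof.
move=> HX HY; have X24 := half_large HY.
have av s : size s < 7 -> exists2 x, x \in X & x \notin s.
  by move=> ss; apply: exists_avoiding; apply: leq_trans X24; apply: leq_trans ss _.
have [a aX _] := av [::] isT; have [b bX ba] := av [:: a] isT; have [c cX cab] := av [:: a; b] isT.
move: ba cab; rewrite !inE !negb_or => ba /andP[ca cb].
have hC u v : centers Y (h u v) = centers Y (h v u).
  apply/setP => x; rewrite !inE; congr (_ && (_ < _)); apply: eq_card => y.
  by rewrite !inE (h12 fg).
have step u v w : u \in X -> v \in X -> w \in X -> distinct3 u v w ->
    {subset centers Y (h u v) <= centers Y (h u w)}.
  by move=> uX vX wX d; apply/subsetP; case: (half_centers HX HY uX vX wX d).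
have dacb : distinct3 a c b by rewrite /distinct3 [a == c]eq_sym ca cb ba.
have [_ C2] := half_centers HX HY aX cX bX dacb.
have [x xC] : exists x, x \in centers Y (h a b) by apply/card_gt0P; rewrite C2.
exists x; first by move: xC; rewrite inE => /andP[].
have xa v : v \in X -> v != a -> x \in centers Y (h a v).
  move=> vX va; have [->//|vb] := eqVneq v b.
  by apply: step xC => //; rewrite /distinct3 [a == b]eq_sym ba [b == v]eq_sym vb va.
move=> u v uX vX uv; have [ua|ua] := eqVneq u a.
  by rewrite ua; apply: xa => //; rewrite -ua eq_sym.
have [va|va] := eqVneq v a; first by rewrite va hC; exact: xa.
apply: (step u a v) => //; last by rewrite hC; exact: xa.
by rewrite /distinct3 ua [a == v]eq_sym va eq_sym uv.
Qed.

(** Let [x] be a common centre for the pairs of [X]. The pairs [x b] have their centres in one set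
    of size two; take [u] outside it. Among the edges [u v x b], each [v] has at least 6 choices of
    [b] and each [b] at most 5 of [v], though the sides are equal. *)
Lemma no_complete_parity X Y : half X Y -> half Y X -> #|X| = #|Y| -> False.
Proof.
move=> HX HY cXY; have [x xY xC] := common_center HX HY.
have [b0 b0Y b0x] : exists2 b, b \in Y & b \notin [:: x].
  by apply: exists_avoiding; apply: leq_trans (half_large HX).
rewrite inE in b0x.
have [b1 b1Y b1n] : exists2 b, b \in Y & b \notin [:: x; b0].
  by apply: exists_avoiding; apply: leq_trans (half_large HX).
move: b1n; rewrite !inE negb_or => /andP[b1x b10].
have sub b : b \in Y -> b != x -> {subset centers X (h x b) <= centers X (h x b0)}.
  move=> bY bx; have [->//|bb0] := eqVneq b b0.
  apply/subsetP; case: (half_centers HY HX xY bY b0Y _) => //.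
  by rewrite /distinct3 eq_sym bx bb0 b0x.
have [_ C2] : centers X (h x b1) \subset centers X (h x b0) /\ #|centers X (h x b0)| = 2.
  by apply: (half_centers HY HX) => //; rewrite /distinct3 eq_sym b1x b10 b0x.
have [u uX uC] : exists2 u, u \in X & u \notin enum (centers X (h x b0)).
  by apply: exists_avoiding; rewrite -cardE C2; apply: leq_trans (half_large HY).
rewrite mem_enum in uC.
have upper b : b \in Y :\ x -> \sum_(v in X :\ u) h u v x b <= 5.
  move=> /setD1P[bx bY]; have : u \notin centers X (h x b) by apply: contra uC; exact: sub.
  rewrite inE uX /= -leqNgt => le5; apply: leq_trans le5.
  rewrite sum_mem_card; apply: subset_leq_card; apply/subsetP => v; rewrite !inE => /andP[/andP[_ ->]] /=.
  by rewrite (hrot fg x) (hrot fg b).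
have lower v : v \in X :\ u -> 6 <= \sum_(b in Y :\ x) h u v x b.
  move=> /setD1P[vu vX]; have := xC u v uX vX; rewrite eq_sym vu inE xY /= => /(_ isT) le6.
  apply: leq_trans le6 _; rewrite sum_mem_card; apply: subset_leq_card; apply/subsetP => b.
  rewrite !inE => /andP[bY H]; rewrite H bY !andbT.
  by have [_ [_ _]] := h_distinct fg H; rewrite eq_sym.
have h1 : 6 * #|X :\ u| <= \sum_(v in X :\ u) \sum_(b in Y :\ x) h u v x b.
  by rewrite mulnC -sum_nat_const; apply: leq_sum => v /lower.
have h2 : \sum_(v in X :\ u) \sum_(b in Y :\ x) h u v x b <= 5 * #|Y :\ x|.
  by rewrite exchange_big /= mulnC -sum_nat_const; apply: leq_sum => b /upper.
have := cardsD1 u X; have := cardsD1 x Y; rewrite uX xY.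
have := half_large HX; lia.
Qed.

End CompleteParity.

Lemma no_large_PG23_free : exists n0, forall (T : finType) (h : T -> T -> T -> T -> bool),
  fourgraph h -> PG23_free h -> codegree_half h -> n0 <= #|T| -> False.
Proof.
have [n1 H] := exact_parity_partition.
exists (n1 + 75) => T h fg free cod nn; have [|A [iA iB cA cB]] := H T h fg free cod; first by lia.
have cC := cardsC A.
have Nb_sub (X : {set T}) x y z : (forall x y z w, x \in X -> y \in X -> z \in X -> w \in X -> ~~ h x y z w) ->
    x \in X -> y \in X -> z \in X -> Nb h x y z \subset ~: X.
  move=> iX xX yX zX; apply/subsetP => w; rewrite !inE => hw; apply/negP => wX.
  by move/negP: (iX x y z w xX yX zX wX).
have iB' x y z w : x \in ~: A -> y \in ~: A -> z \in ~: A -> w \in ~: A -> ~~ h x y z w.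
  by rewrite !inE; exact: iB.
(* Neighbours of a triple in an edgeless side lie on the other side. Hence both sides have exactly
   half of the vertices, and each such triple sees all of the opposite side. *)
have half_le (X : {set T}) : (forall x y z w, x \in X -> y \in X -> z \in X -> w \in X -> ~~ h x y z w) ->
    2 < #|X| -> #|T| <= 2 * #|~: X|.
  move=> iX /card_gt2P[x [y [z [[xX yX zX] [xy yz zx]]]]].
  apply: leq_trans (cod _ _ _ xy yz zx) _; rewrite leq_mul2l /=.
  by apply: subset_leq_card; exact: Nb_sub.
have lA : #|T| <= 2 * #|~: A| by apply: half_le => //; lia.
have lB : #|T| <= 2 * #|A| by rewrite -[A in X in _ <= X]setCK; apply: half_le => //; lia.
have cAB : #|A| = #|~: A| by lia.
have mkhalf (X : {set T}) : (forall x y z w, x \in X -> y \in X -> z \in X -> w \in X -> ~~ h x y z w) ->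
    #|T| = 2 * #|X| -> #|~: X| = #|X| -> half h X (~: X).
  move=> iX cX cX'; split; first by lia.
    move=> x y z w xX yX zX /and3P[xy yz zx] wX.
    have : Nb h x y z == ~: X.
      by rewrite eqEcard Nb_sub //= cX'; have := cod _ _ _ xy yz zx; lia.
    by move/eqP/setP/(_ w); rewrite inE wX.
  (* At most [#|X| - 2] of the at least [#|X|] neighbours of [u], [v], [b] lie in [X], so two lie
     opposite. *)
  move=> u v b uX vX uv bX.
  have ub : u != b by apply: contraTneq bX => <-; rewrite inE uX.
  have vb : v != b by apply: contraTneq bX => <-; rewrite inE vX.
  have := cod u v b uv vb; rewrite eq_sym => /(_ ub).
  have : #|Nb h u v b :&: X| <= #|X| - 2.
    have c2 : #|[set u; v]| = 2 by rewrite cards2 uv.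
    rewrite -c2 -[#|X|](cardsID [set u; v]) (_ : X :&: [set u; v] = [set u; v]); last first.
      by apply/setIidPr; apply/subsetP => t; rewrite !inE => /orP[]/eqP->.
    rewrite addKn; apply: subset_leq_card; apply/subsetP => t; rewrite !inE => /andP[hE ->].
    by have [_ [ut vt _]] := h_distinct fg hE; rewrite negb_or ![t == _]eq_sym ut vt.
  have : #|Nb h u v b :&: ~: X| = #|gnbr (~: X) (h u v) b|.
    by apply: eq_card => t; rewrite !inE andbC.
  have := cardsID X (Nb h u v b); rewrite setDE; lia.
apply: (no_complete_parity fg free (mkhalf A iA _ _) _ cAB); try lia.
by rewrite -{2}[A]setCK; apply: mkhalf => //; rewrite ?setCK; lia.
Qed.

(** * Coordinates of PG_2(3) *)

(* Points of PG_2(3) are numbered as in [PG23_free]: 0 is i, 1 + m is pm and 4 + 3 * y + z is ayz,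
   with homogeneous coordinates (0,0,1), (0,1,m) and (1,y,z); over F_3 every unit is its own inverse. *)
Definition pg_code (x y z : nat) : nat :=
  if x == 0 then (if y == 0 then 0 else 1 + (z * y) %% 3) else 4 + 3 * ((y * x) %% 3) + (z * x) %% 3.

Definition pg_lines : seq (seq nat) :=
  [:: [:: 0; 1; 2; 3]; [:: 0; 4; 5; 6]; [:: 0; 7; 8; 9]; [:: 0; 10; 11; 12];
      [:: 1; 4; 7; 10]; [:: 1; 5; 8; 11]; [:: 1; 6; 9; 12];
      [:: 2; 4; 8; 12]; [:: 2; 5; 9; 10]; [:: 2; 6; 7; 11];
      [:: 3; 4; 9; 11]; [:: 3; 5; 7; 12]; [:: 3; 6; 8; 10] ].

(** Vectors over F_3 are encoded by natural digits, so that the facts below are decided by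
    computation on 27 triples. *)
Definition dvec := (nat * nat * nat)%type.
Definition dvecs : seq dvec := [seq (p, z) | p <- [seq (x, y) | x <- iota 0 3, y <- iota 0 3], z <- iota 0 3].
Definition dcode (v : dvec) := pg_code v.1.1 v.1.2 v.2.
Definition dcomb (a : nat) (u : dvec) (b : nat) (v : dvec) : dvec :=
  ((a * u.1.1 + b * v.1.1) %% 3, (a * u.1.2 + b * v.1.2) %% 3, (a * u.2 + b * v.2) %% 3).
Definition d0 : dvec := (0, 0, 0).
Definition dindep (u v : dvec) := (u != d0) && all (fun c => v != dcomb c u 0 u) (iota 0 3).
Definition dspan (u v : dvec) := [:: dcode u; dcode v; dcode (dcomb 1 u 1 v); dcode (dcomb 1 u 2 v)].

Lemma dcode_scale : all (fun v => all (fun c => (dcomb c v 0 v != d0) ==> (dcode (dcomb c v 0 v) == dcode v)) (iota 0 3)) dvecs.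
Proof. by vm_compute. Qed.

Lemma dcode_inj : all (fun u => all (fun v => [&& u != d0, v != d0 & dcode u == dcode v] ==>
  has (fun c => v == dcomb c u 0 u) (iota 0 3)) dvecs) dvecs.
Proof. by vm_compute. Qed.

Lemma dcode_lt : all (fun v => dcode v < 13) dvecs.
Proof. by vm_compute. Qed.

Lemma dspan_line : all (fun u => all (fun v => dindep u v ==> has (perm_eq (dspan u v)) pg_lines) dvecs) dvecs.
Proof. by vm_compute. Qed.

Lemma dspan_mem : all (fun u => all (fun v => all (fun a => all (fun b => (dcomb a u b v != d0) ==>
  (dcode (dcomb a u b v) \in dspan u v)) (iota 0 3)) (iota 0 3)) dvecs) dvecs.
Proof. by vm_compute. Qed.

Lemma dindep_neq0 : all (fun u => all (fun v => dindep u v ==>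
  [&& u != d0, v != d0, dcomb 1 u 1 v != d0 & dcomb 1 u 2 v != d0]) dvecs) dvecs.
Proof. by vm_compute. Qed.

Section Coordinates.
Import GRing.Theory.
Local Open Scope ring_scope.

Definition digits (v : vec3) : dvec :=
  (v 0 0 : nat, v 0 1 : nat, v 0 (2%:R : 'I_3) : nat).

Lemma F3_lt (a : 'F_3) : (a < 3)%N. Proof. exact: ltn_ord. Qed.

Lemma digits_dvecs v : digits v \in dvecs.
Proof.
have i3 (a : 'F_3) : (a : nat) \in iota 0 3 by rewrite mem_iota; exact: F3_lt.
by apply: (allpairs_f pair); rewrite ?i3 //; apply: (allpairs_f pair); exact: i3.
Qed.

Lemma digits_inj : injective digits.
Proof.
move=> u v [e0 e1 e2]; apply/rowP => i.
have [->|[->|->]] : i = 0 \/ i = 1 \/ i = (2%:R : 'I_3).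
  by case: i => [[|[|[|//]]]] ?; [left|right;left|right;right]; apply: val_inj.
- exact: val_inj e0.
- exact: val_inj e1.
- exact: val_inj e2.
Qed.

Lemma digits_comb (a b : 'F_3) (u v : vec3) : digits (a *: u + b *: v) = dcomb a (digits u) b (digits v).
Proof.
have E (i : 'I_3) : nat_of_ord ((a *: u + b *: v) 0 i)%R = ((a * u 0%R i + b * v 0%R i) %% 3)%N.
  by rewrite !mxE /= modnDml modnDmr.
by rewrite /digits /dcomb /= !E.
Qed.

Lemma digits0 : digits 0 = d0.
Proof. by rewrite /digits !mxE. Qed.

Lemma digits_eq0 v : (digits v == d0) = (v == 0).
Proof. by rewrite -digits0 (inj_eq digits_inj). Qed.

Lemma digits_scale (a : 'F_3) u : digits (a *: u) = dcomb a (digits u) 0 (digits u).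
Proof. by rewrite -[a *: u]addr0 -(scale0r u) digits_comb. Qed.

Lemma F3_nat c : (c < 3)%N -> exists a : 'F_3, (a : nat) = c.
Proof. by move=> lt; exists (Ordinal (lt : (c < (Zp_trunc (pdiv 3)).+2)%N)). Qed.

Lemma F3_iota (a : 'F_3) : (a : nat) \in iota 0 3.
Proof. by rewrite mem_iota; exact: F3_lt. Qed.

(** If one vector is a multiple of the other, the matrix factors through a single row and has rank
    at most 1. *)
Lemma rank2_dindep u v : \rank (col_mx u v) = 2 -> dindep (digits u) (digits v).
Proof.
move=> rk; have no (M : 'M['F_3]_(1 + 1, 1)) w : col_mx u v = M *m w -> False.
  by move=> E; move: (mxrankM_maxr M w); rewrite -E rk; have := rank_leq_row w; lia.
rewrite /dindep digits_eq0; apply/andP; split.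
  apply/eqP => u0; apply: (no (col_mx 0 1%:M) v).
  by rewrite mul_col_mx mul1mx mul0mx u0.
apply/allP => c; rewrite mem_iota /= => /F3_nat[a <-]; rewrite -digits_scale (inj_eq digits_inj).
apply/eqP => va; apply: (no (col_mx 1%:M a%:M) u).
by rewrite mul_col_mx mul1mx mul_scalar_mx va.
Qed.

Definition span1 (v : vec3) : {set vec3} := [set a *: v | a : 'F_3].

Lemma span1_point v : v != 0 -> span1 v \in pg_points.
Proof. by move=> v0; rewrite inE; apply/existsP; exists v; rewrite v0 /=. Qed.

Section Embedding.
Variables (T : finType) (x0 : T) (pts : seq T).

Definition vec_pt v : T := nth x0 pts (dcode (digits v)).

(** Any nonzero vector of the point will do, as [vec_pt] ignores scalars; the default [0] concerns
    only sets without one. *)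
Definition point_pt (S : {set vec3}) : T := vec_pt (odflt 0 [pick v in S | v != 0]).

Lemma vec_pt_scale (a : 'F_3) v : a *: v != 0 -> vec_pt (a *: v) = vec_pt v.
Proof.
move=> av0; have /allP/(_ _ (F3_iota a)) := allP dcode_scale _ (digits_dvecs v).
by rewrite /vec_pt -digits_scale digits_eq0 av0 /= => /eqP->.
Qed.

Lemma point_pt_span v : v != 0 -> point_pt (span1 v) = vec_pt v.
Proof.
move=> v0; rewrite /point_pt; case: pickP => [w /andP[/imsetP[a _ ->] av0]|/(_ v)] /=.
  exact: vec_pt_scale.
by rewrite v0 andbT; move/negP; case; apply/imsetP; exists 1; rewrite ?scale1r.
Qed.

Lemma span1_vec_pt_inj u v : uniq pts -> size pts = 13%N -> u != 0 -> v != 0 ->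
  vec_pt u = vec_pt v -> span1 u = span1 v.
Proof.
move=> U sz u0 v0 /eqP; rewrite /vec_pt nth_uniq ?sz //; try exact: (allP dcode_lt _ (digits_dvecs _)).
move=> e; have /allP/(_ _ (digits_dvecs v)) := allP dcode_inj _ (digits_dvecs u).
rewrite !digits_eq0 u0 v0 e => /implyP/(_ isT)/hasP[c]; rewrite mem_iota /= => /F3_nat[a <-].
rewrite -digits_scale (inj_eq digits_inj) => /eqP E.
have a0 : a != 0 by apply: contraNneq v0 => a0; rewrite E a0 scale0r.
apply/setP => w; apply/imsetP/imsetP => -[b _ ->].
  by exists (b / a) => //; rewrite E scalerA divfK.
by exists (b * a) => //; rewrite E scalerA.
Qed.

(* Up to scalars the nonzero vectors of a plane are [u], [v], [u + v] and [u + 2 v]. *)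
Lemma image_pg_line u v : dindep (digits u) (digits v) ->
  let W : {set vec3} := [set a *: u + b *: v | a : 'F_3, b : 'F_3] in
  point_pt @: pg_line W = [set x in map (nth x0 pts) (dspan (digits u) (digits v))].
Proof.
move=> ind W.
have [t t2] : exists a : 'F_3, (a : nat) = 2%N by exact: F3_nat.
have d1 : digits (u + v) = dcomb 1 (digits u) 1 (digits v).
  by rewrite -{1}[u]scale1r -{1}[v]scale1r digits_comb.
have d2 : digits (u + t *: v) = dcomb 1 (digits u) 2 (digits v).
  by rewrite -{1}[u]scale1r digits_comb t2.
have /and4P[u0 v0 uv0 utv0] : [&& u != 0, v != 0, u + v != 0 & u + t *: v != 0].
  have := allP (allP dindep_neq0 _ (digits_dvecs u)) _ (digits_dvecs v).
  by rewrite ind /= -d1 -d2 !digits_eq0.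
have inW (a b : 'F_3) w : w = a *: u + b *: v -> w != 0 -> vec_pt w \in point_pt @: pg_line W.
  move=> E w0; rewrite -(point_pt_span w0); apply: imset_f; rewrite inE span1_point //=.
  apply/subsetP => w' /imsetP[c _ ->]; rewrite E scalerDr !scalerA.
  by apply/imset2P; exists (c * a) (c * b).
apply/setP => x; rewrite in_set; apply/imsetP/idP.
  move=> [P /setIdP[PP PW] ->]; have /existsP[w /andP[w0 /eqP PE]] : [exists v : vec3, (v != 0) && (P == span1 v)].
    by move: PP; rewrite [in X in X -> _]inE.
  have -> : P = span1 w by [].
  rewrite point_pt_span // /vec_pt; apply: map_f.
  have : w \in W.
    by apply: (subsetP PW); rewrite PE; apply/imsetP; exists 1; rewrite ?scale1r.
  move=> /imset2P[a b _ _ E]; rewrite E in w0 *.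
  have := allP (allP (allP (allP dspan_mem _ (digits_dvecs u)) _ (digits_dvecs v)) _ (F3_iota a)) _ (F3_iota b).
  by rewrite -digits_comb digits_eq0 w0.
move=> xin; apply/imsetP; move: xin.
rewrite /dspan -d1 -d2 /= !inE => /or4P[] /eqP->.
- by apply: (inW 1 0) => //; rewrite scale1r scale0r addr0.
- by apply: (inW 0 1) => //; rewrite scale1r scale0r add0r.
- by apply: (inW 1 1) => //; rewrite !scale1r.
- by apply: (inW 1 t) => //; rewrite !scale1r.
Qed.

End Embedding.
End Coordinates.

(** * From set systems to symmetric relations *)

Definition edge_rel (T : finType) (E : {set {set T}}) (x y z w : T) : bool := [set x; y; z; w] \in E.

Lemma edge_rel_fourgraph (T : finType) (E : {set {set T}}) : is_kgraph 4 E -> fourgraph (edge_rel E).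
Proof.
move=> k4; split=> [x y z w|x y z w|x y z w].
- by rewrite /edge_rel [[set x; y]]setUC.
- rewrite /edge_rel; congr (_ \in E); apply/setP => t; rewrite !inE.
  by case: (t == x); case: (t == y); case: (t == z); case: (t == w).
- move/k4; case: eqVneq => // ->; rewrite setUid => c4.
  have := card_setU3_le [set y] [set z] [set w]; rewrite c4 !cards1; lia.
Qed.

Lemma contains_of_config (T : finType) (E : {set {set T}}) (x0 : T) pts :
  uniq pts -> size pts = 13 ->
  (forall l, l \in pg_lines -> [set x in map (nth x0 pts) l] \in E) -> contains_PG23 E.
Proof.
move=> U sz edges; exists (point_pt x0 pts); split.
  move=> P Q; rewrite !inE => /existsP[u /andP[u0 /eqP->]] /existsP[v /andP[v0 /eqP->]].
  rewrite -/(span1 u) -/(span1 v) !point_pt_span // => e.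
  exact: span1_vec_pt_inj U sz u0 v0 e.
move=> W; rewrite inE => /existsP[u /existsP[v /andP[/eqP rk /eqP->]]].
have ind := rank2_dindep rk; rewrite image_pg_line //.
have /implyP/(_ ind)/hasP[l ll pl] := allP (allP dspan_line _ (digits_dvecs u)) _ (digits_dvecs v).
rewrite (_ : [set x in _] = [set x in map (nth x0 pts) l]); first exact: edges.
by apply/setP => x; rewrite !in_set; apply: perm_mem; exact: perm_map.
Qed.

Lemma edge_rel_PG23_free (T : finType) (E : {set {set T}}) :
  is_kgraph 4 E -> ~ contains_PG23 E -> PG23_free (edge_rel E).
Proof.
move=> k4 free i p0 p1 p2 a00 a01 a02 a10 a11 a12 a20 a21 a22.
have fg := edge_rel_fourgraph k4.
move=> e1 e2 e3 e4 e5 e6 e7 e8 e9 e10 e11 e12 e13; apply: free.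
apply: (@contains_of_config _ _ i [:: i; p0; p1; p2; a00; a01; a02; a10; a11; a12; a20; a21; a22]) => //.
  (* Any two of the thirteen points lie on a common line, and the vertices of an edge are
     distinct. *)
  have d := h_distinct fg.
  have [[? ? ?] [? ? ?]] := d _ _ _ _ e1; have [[? ? ?] [? ? ?]] := d _ _ _ _ e2.
  have [[? ? ?] [? ? ?]] := d _ _ _ _ e3; have [[? ? ?] [? ? ?]] := d _ _ _ _ e4.
  have [[? ? ?] [? ? ?]] := d _ _ _ _ e5; have [[? ? ?] [? ? ?]] := d _ _ _ _ e6.
  have [[? ? ?] [? ? ?]] := d _ _ _ _ e7; have [[? ? ?] [? ? ?]] := d _ _ _ _ e8.
  have [[? ? ?] [? ? ?]] := d _ _ _ _ e9; have [[? ? ?] [? ? ?]] := d _ _ _ _ e10.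
  have [[? ? ?] [? ? ?]] := d _ _ _ _ e11; have [[? ? ?] [? ? ?]] := d _ _ _ _ e12.
  have [[? ? ?] [? ? ?]] := d _ _ _ _ e13.
  rewrite /= !inE !negb_or.
  by do ?[apply/andP; split]; first [done | rewrite eq_sym; done].
have set4 (x y z w : T) : [set t in [:: x; y; z; w]] = [set x; y; z; w].
  by apply/setP => t; rewrite !inE !orbA.
by move=> l; rewrite !inE; do 12?[case/orP]; move/eqP->; rewrite /= set4.
Qed.

Lemma delta_le (s : nat) (T : finType) (E : {set {set T}}) (S : {set T}) :
  #|S| = s -> delta s E <= #|nbhd E S|.
Proof.
move=> cS; rewrite /delta; have := mem_index_enum S.
elim: (index_enum _) => // S' r IH; rewrite inE big_cons => /orP[/eqP<-|/IH le].
  by rewrite cS eqxx geq_minl.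
by case: ifP => // _; apply: leq_trans le; exact: geq_minr.
Qed.

(** The members of [nbhd] of a triple are singletons, since edges have four vertices. *)
Lemma edge_rel_codegree (T : finType) (E : {set {set T}}) :
  is_kgraph 4 E -> #|T| <= 2 * delta 3 E -> codegree_half (edge_rel E).
Proof.
move=> k4 le x y z xy yz zx; apply: leq_trans le _; rewrite leq_mul2l /=.
have c3 : #|[set x; y; z]| = 3.
  by rewrite setUC cardsU1 cards2 !inE xy negb_or zx eq_sym yz.
apply: leq_trans (delta_le E c3) _.
apply: leq_trans (leq_imset_card set1 _); apply: subset_leq_card; apply/subsetP => U.
rewrite inE => /andP[dis US]; have := k4 _ US.
rewrite cardsU setIC (disjoint_setI0 dis) cards0 subn0 c3 => cU.
have /cards1P[w Uw] : #|U| == 1 by apply/eqP; lia.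
by rewrite Uw imset_f // inE /edge_rel -Uw.
Qed.

Theorem mainTheorem15 :
  exists n0 : nat,
    forall (T : finType) (E : {set {set T}}),
      is_kgraph 4 E ->
      (n0 <= #|T|)%N ->
      ~ contains_PG23 E ->
      (2 * delta 3 E < #|T|)%N.
Proof.
have [n0 H] := no_large_PG23_free; exists n0 => T E k4 nn free.
rewrite ltnNge; apply/negP => le.
exact: H (edge_rel_fourgraph k4) (edge_rel_PG23_free k4 free) (edge_rel_codegree k4 le) nn.
Qed.
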